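(* Let $T$ be an arbitrary connected non-bipartite graph with a distinguished vertex labelled $0$, and let $N=|V(T)|$. Let $\mathcal{H}$ be any one of the following three sets of graphs: \begin{itemize} \item $\mathcal{H}_1(T)=\{T',\ db_{0,1}(T'),\ C_{2N}\}$; \item $\mathcal{H}_2(T)=\{e,\ T',\ db_{1,2}(db_0^2(T)'')\}$; \item $\mathcal{H}_3(T)=\{T,\ T',\ db_{1,2}(db_0(T^{(N)})'')\}$. \end{itemize} Then $\mathcal{H}$ is forcing, and for any two distinct graphs $F_1,F_2\in\mathcal{H}$ the pair $\{F_1,F_2\}$ is not forcing.
   Context: All graphs are finite and simple (undirected, no loops, no multiple edges). For graphs $H,G$, let $\hom(H,G)$ be the number of graph homomorphisms from $H$ to $G$. Quasirandom and forcing. Graph sequences $\{G_n\}$ are indexed by $n$ with $|V(G_n)|=n$. Such a sequence is quasirandom with density $p$ if for every graph $H$ we have $\hom(H,G_n)=(p^{|E(H)|}+o(1))\,n^{|V(H)|}$ (one of the standard equivalent characterisations due to Chung, Graham and Wilson). A set of graphs $\mathcal{H}$ is forcing if for every sequence $\{G_n\}$ with $|V(G_n)|=n$ and every constant $p\in(0,1)$: if $\hom(H,G_n)=(p^{|E(H)|}+o(1))\,n^{|V(H)|}$ for every $H\in\mathcal{H}$, then $\{G_n\}$ is quasirandom with density $p$. Constructions. $e$ is the graph consisting of a single edge; $C_{k}$ is the cycle on $k$ vertices. For a graph $F$ with some labelled vertices and a set $I$ of labels, the doubling $db_I(F)$ is the graph obtained by taking two disjoint copies of $F$ and identifying, for each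 label in $I$, the two vertices carrying that label (an edge of $F$ both of whose endpoints have labels in $I$ becomes a single edge). In $db_I(F)$ the vertices with labels in $I$ keep their labels; all other vertices are labelled arbitrarily (they should be thought of as having fresh labels, so their old labels are forgotten). Braces are omitted: $db_0=db_{\{0\}}$, $db_{0,1}=db_{\{0,1\}}$, $db_{1,2}=db_{\{1,2\}}$. Also $db_0^2(F)=db_0(db_0(F))$, which is four copies of $F$ glued at the vertex $0$. For a graph $F$ with a vertex labelled $0$ and a positive integer $k$, $F^{(k)}$ is the graph obtained from $F$ by adding $k$ new vertices, labelled $1,\dots,k$, each joined by an edge to the vertex $0$ and to nothing else; the vertex $0$ keeps its label. Write $F'=F^{(1)}$ and $F''=F^{(2)}$. Thus $db_0^2(T)''$ means $(db_0^2(T))''$, and $db_0(T^{(N)})''$ means $(db_0(T^{(N)}))''$; in each of these, the vertices with labels $1$ and $2$ are exactly the two new vertices added by the operation $''$. For reference, with $M=|E(T)|$: $db_{0,1}(T')$ has $2N$ vertices and $2M+1$ edges; $db_{1,2}(db_0^2(T)'')$ has $8N-4$ vertices and $8M+4$ edges; $db_{1,2}(db_0(T^{(N)})'')$ has $8N$ vertices and $4M+4+4N$ edges. *)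

(* Defs.v *)
From HB Require Import structures.
From mathcomp Require Import all_boot all_order all_algebra.

Set Implicit Arguments.
Unset Strict Implicit.
Unset Printing Implicit Defensive.

Record sgraph := SGraph {
  vertex :> finType;
  adj : rel vertex;
  adj_sym : symmetric adj;
  adj_irrefl : irreflexive adj }.

Arguments adj {s} x y.

Definition edges (G : sgraph) : {set {set G}} :=
  [set A | [exists x : G, exists y : G, adj x y && (A == [set x; y])]].

Definition is_hom (H G : sgraph) (f : {ffun H -> G}) : bool :=
  [forall x, forall y, adj x y ==> adj (f x) (f y)].

Definition hom (H G : sgraph) : nat := #|[set f : {ffun H -> G} | is_hom f]|.

Definition connected_graph (G : sgraph) : Prop := forall x y : G, connect adj x y.

Definition bipartite_graph (G : sgraph) : Prop :=
  exists c : G -> bool, forall x y : G, adj x y -> c x != c y.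

Lemma edge_adj_sym : symmetric (fun x y : bool => x != y).
Proof. by move=> x y; rewrite eq_sym. Qed.

Lemma edge_adj_irrefl : irreflexive (fun x y : bool => x != y).
Proof. by move=> x; rewrite eqxx. Qed.

Definition edge_graph : sgraph := SGraph edge_adj_sym edge_adj_irrefl.

Section Cycle.
Variable k : nat.

(* The condition [i != j] only matters for [k = 1]; this is the cycle on [k]
   vertices for [k >= 3]. *)
Definition cycle_adj (i j : 'I_k) : bool :=
  (i != j) && ((ordS i == j) || (ordS j == i)).

Lemma cycle_adj_sym : symmetric cycle_adj.
Proof. by move=> i j; rewrite /cycle_adj eq_sym orbC. Qed.

Lemma cycle_adj_irrefl : irreflexive cycle_adj.
Proof. by move=> i; rewrite /cycle_adj eqxx. Qed.

Definition cycle_graph : sgraph := SGraph cycle_adj_sym cycle_adj_irrefl.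
End Cycle.

(* [lab i] is the vertex carrying the label [i], if there is one. *)
Record lgraph := LGraph {
  graph_of :> sgraph;
  lab : nat -> option graph_of }.

Arguments lab : clear implicits.

Definition rooted (T : sgraph) (z : T) : lgraph :=
  @LGraph T (fun i => if i == 0 then Some z else None).

Section Doubling.
Variables (I : seq nat) (F : lgraph).

Definition glued (x : F) : bool := has (fun i => lab F i == Some x) I.

(* The pair [(x, b)] is the vertex [x] in copy [b] of [F]. A glued vertex lies
   in both copies and is represented by [(x, false)] only. *)
Definition db_vertex : finType := {u : F * bool | glued u.1 ==> ~~ u.2}.

Definition db_adj (u v : db_vertex) : bool :=
  let: (x, b) := val u in
  let: (y, c) := val v in
  adj x y && [|| glued x, glued y | b == c].

Lemma db_adj_sym : symmetric db_adj.
Proof.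
move=> [[x b] hx] [[y c] hy]; rewrite /db_adj /= adj_sym (eq_sym b).
by case: (glued x); case: (glued y).
Qed.

Lemma db_adj_irrefl : irreflexive db_adj.
Proof. by move=> [[x b] hx]; rewrite /db_adj /= adj_irrefl. Qed.

Lemma db_inj0_subproof (x : F) : glued (x, false).1 ==> ~~ (x, false).2.
Proof. exact: implybT. Qed.

Definition db_inj0 (x : F) : db_vertex := Sub (x, false) (db_inj0_subproof x).

Definition db : lgraph :=
  @LGraph (SGraph db_adj_sym db_adj_irrefl)
    (fun i => if i \in I then omap db_inj0 (lab F i) else None).
End Doubling.

Section Pendant.
Variables (k : nat) (F : lgraph).

Definition pendant_adj (u v : (F + 'I_k)%type) : bool :=
  match u, v with
  | inl x, inl y => adj x y
  | inl x, inr _ => lab F 0 == Some x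
  | inr _, inl y => lab F 0 == Some y
  | inr _, inr _ => false
  end.

Lemma pendant_adj_sym : symmetric pendant_adj.
Proof. by move=> [x|i] [y|j] //=; rewrite adj_sym. Qed.

Lemma pendant_adj_irrefl : irreflexive pendant_adj.
Proof. by move=> [x|i] //=; rewrite adj_irrefl. Qed.

(* The new vertices carry the labels 1, ..., k; every label of [F] other than 0
   is forgotten. *)
Definition pendant : lgraph :=
  @LGraph (SGraph pendant_adj_sym pendant_adj_irrefl)
    (fun i => if i is j.+1 then omap inr (insub j : option 'I_k)
              else omap inl (lab F 0)).
End Pendant.

From mathcomp Require Import all_classical all_reals all_analysis.
Import GRing.Theory Num.Theory numFieldNormedType.Exports.

Local Open Scope classical_set_scope.
Local Open Scope ring_scope.

(* hom(H, G_n) = (p^|E(H)| + o(1)) n^|V(H)| *)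
Definition hom_asymp (R : realType) (G : nat -> sgraph) (p : R) (H : sgraph) :
    Prop :=
  exists2 o1 : nat -> R, o1 @ \oo --> (0 : R) &
    forall n, (hom H (G n))%:R = (p ^+ #|edges H| + o1 n) * n%:R ^+ #|H|.

Definition quasirandom (R : realType) (G : nat -> sgraph) (p : R) : Prop :=
  forall H : sgraph, hom_asymp G p H.

(* The universe of [sgraph] is too large for [set sgraph] of classical_sets. *)
Definition graph_set := sgraph -> Prop.

Definition pair_set (F1 F2 : sgraph) : graph_set :=
  fun F => F = F1 \/ F = F2.

Definition triple_set (F1 F2 F3 : sgraph) : graph_set :=
  fun F => [\/ F = F1, F = F2 | F = F3].

Definition forcing (R : realType) (Hs : graph_set) : Prop :=
  forall (G : nat -> sgraph) (p : R),
    (forall n, #|G n| = n) -> 0 < p < 1 ->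
    (forall H, Hs H -> hom_asymp G p H) -> quasirandom G p.

Definition H1 (T : sgraph) (z : T) : graph_set :=
  let T0 := rooted z in
  triple_set (pendant 1 T0)
             (db [:: 0; 1]%N (pendant 1 T0))
             (cycle_graph (2 * #|T|)).

Definition H2 (T : sgraph) (z : T) : graph_set :=
  let T0 := rooted z in
  triple_set edge_graph
             (pendant 1 T0)
             (db [:: 1; 2]%N (pendant 2 (db [:: 0]%N (db [:: 0]%N T0)))).

Definition H3 (T : sgraph) (z : T) : graph_set :=
  let T0 := rooted z in
  triple_set T
             (pendant 1 T0)
             (db [:: 1; 2]%N (pendant 2 (db [:: 0]%N (pendant #|T| T0)))).

(* Main.v *)
Require Import Defs.
From mathcomp Require Import all_boot all_order all_algebra.
From mathcomp Require Import all_reals.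
From mathcomp Require Import all_classical all_analysis perm zify ring lra.
Import Order.TTheory GRing.Theory Num.Theory numFieldNormedType.Exports.

(** Let T have N vertices and M edges. Fix the host graph and let f(x) be the
    number of homomorphisms of T that send the root to x, d(x) the degree of x,
    both normalised to lie in [0,1]; E denotes the average over the vertices of
    the host. Pendant edges multiply
    rooted counts by d and gluing at the root squares them, so every density in
    question is a moment: T has density E[f], T' has E[f d], db_{0,1}(T') has
    E[f^2 d], and the last graphs of the second and third family are copies of
    C_4 in which two opposite vertices carry the weight f^4, respectively
    (f d^N)^2 (lemmas [tdens_T] to [tdens_cycle]).

    Forcing. For each family the prescribed densities make a chain of
    Cauchy-Schwarz and log-convexity inequalities tight in the limit. For the
    first one, (E[f d])^2 <= E[d] E[f^2 d] and E[d]^(2N) <= t(C_2N) pin down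
    E[d] = p. For the other two, tightness also shows that f and d are almost
    constant in the mean, so the weights on the C_4 can be divided out
    ([glued_C4_near]) and t(C_4) tends to p^4. In all cases the edge density and
    the density of one even cycle of length at least 4 are those of a random
    graph, and [quasirandom_criterion] applies. Its proof avoids eigenvalues:
    for a symmetric operator A the numbers |A^k v|^2 form a log-convex sequence,
    so on functions of mean zero the operator is small as soon as one of its
    powers is close to averaging; hence the graph is close to the constant p in
    the cut norm, and the densities of all graphs follow by removing edges one
    at a time ([counting_lemma]).

    Pairs. One path of limit objects handles all nine pairs. It starts at
    K_{m,m} with each vertex replaced by a clique, where the copies of T are rare
    (T is not bipartite) but evenly spread (the object is vertex-transitive), and
    leads to m disjoint cliques by shrinking one side; half of the vertices
    are isolated throughout. Write e(F) for the number of edges of F. At the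
    start f is constant and t(F) has the order f^i, where i counts the copies of T
    in F; at the end t(F) has the order m^(1-|F|). One has M >= N because T
    is connected and not bipartite, and this makes
    t(F1)^(1/e(F1)) - t(F2)^(1/e(F2)) change sign along the path for each pair,
    up to exchanging F1 and F2. Where it vanishes, its two terms
    have a common value p, and both graphs have the density they have in
    a random graph of density p, whereas the isolated vertices exclude
    quasirandomness ([not_forcing_pair]). *)

Set Implicit Arguments.
Unset Strict Implicit.
Unset Printing Implicit Defensive.

(** * Counting homomorphisms into a relation *)

(** Arbitrary relations are allowed as targets: the limit objects used against
    forcing have loops, which stand for cliques. *)
Definition homs (H : sgraph) (V : finType) (A : rel V) : {set {ffun H -> V}} :=
  [set f : {ffun H -> V} | [forall x, forall y, adj x y ==> A (f x) (f y)]].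

Lemma homsP (H : sgraph) (V : finType) (A : rel V) (f : {ffun H -> V}) :
  reflect (forall x y, adj x y -> A (f x) (f y)) (f \in homs H A).
Proof.
rewrite inE; apply: (iffP forallP) => [h x y|h x].
  by have /forallP/(_ y)/implyP := h x.
by apply/forallP => y; apply/implyP; apply: h.
Qed.

Definition rhom (H : sgraph) (z : H) (V : finType) (A : rel V) (v : V) : nat :=
  #|[set f in homs H A | f z == v]|.

Definition deg (V : finType) (A : rel V) (v : V) : nat := #|A v|.

Lemma rhomE (H : sgraph) (z : H) (V : finType) (A : rel V) v :
  rhom z A v = \sum_(f in homs H A) (f z == v).
Proof.
rewrite /rhom -sum1_card [RHS]big_mkcond [LHS]big_mkcond /=.
by apply: eq_bigr => f _; rewrite inE; case: (f \in _); case: (_ == _).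
Qed.

Lemma degE (V : finType) (A : rel V) v : deg A v = \sum_u A v u.
Proof.
rewrite /deg -sum1_card [LHS]big_mkcond; apply: eq_bigr => u _.
by rewrite -topredE /=; case: (A v u).
Qed.

Lemma card_homs_rhom (H : sgraph) (z : H) (V : finType) (A : rel V) :
  #|homs H A| = \sum_v rhom z A v.
Proof.
rewrite -sum1_card (partition_big (fun f : {ffun H -> V} => f z) predT) //=.
apply: eq_bigr => v _; rewrite /rhom -sum1_card.
by apply: eq_bigl => f; rewrite [in RHS]inE.
Qed.

Section Pendant.
Variables (k : nat) (F : lgraph) (z : F) (V : finType) (A : rel V).
Hypotheses (labz : lab F 0 = Some z) (Asym : symmetric A).

Let resl (psi : {ffun pendant k F -> V}) : {ffun F -> V} := [ffun x => psi (inl x)].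
Let resr (psi : {ffun pendant k F -> V}) : {ffun 'I_k -> V} := [ffun j => psi (inr j)].
Let join (p : {ffun F -> V} * {ffun 'I_k -> V}) : {ffun pendant k F -> V} :=
  [ffun u : pendant k F => match u with inl x => p.1 x | inr j => p.2 j end].

(** The images of the new vertices are independent choices among the neighbours of
    the image of the root. The summand g is arbitrary because gluing along the new
    vertices prescribes their images. *)
Lemma sum_pendant (g : {ffun F -> V} -> {ffun 'I_k -> V} -> nat) :
  \sum_(psi in homs (pendant k F) A) g (resl psi) (resr psi) =
  \sum_(phi in homs F A) \sum_(h in ffun_on (A (phi z))) g phi h.
Proof.
have join_hom p q : (join (p, q) \in homs (pendant k F) A) =
    (p \in homs F A) && (q \in ffun_on (A (p z))).
  apply/idP/andP => [/homsP h|[/homsP hp /ffun_onP hq]].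
    split; first by apply/homsP => x y xy; have := h (inl x) (inl y) xy; rewrite !ffunE.
    apply/ffun_onP => j; have := h (inl z) (inr j); rewrite !ffunE /=.
    by rewrite labz; apply.
  apply/homsP => -[x|i] [y|j]; rewrite /= ?labz !ffunE //=; first exact: hp.
    by move=> /eqP [<-]; apply: hq.
  by move=> /eqP [<-]; rewrite Asym; apply: hq.
rewrite pair_big_dep /= (reindex join); last first.
  exists (fun psi => (resl psi, resr psi)) => [[p q] _|psi _].
    by congr pair; apply/ffunP => x; rewrite !ffunE.
  by apply/ffunP => -[x|j]; rewrite !ffunE.
apply: eq_big => [[p q]|[p q] _]; first exact: join_hom.
by congr g; apply/ffunP => x; rewrite !ffunE.
Qed.

Lemma rhom_pendant v : @rhom (pendant k F) (inl z) _ A v = rhom z A v * deg A v ^ k.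
Proof.
rewrite !rhomE big_distrl /=.
have := sum_pendant (fun phi _ => (phi z == v) : nat).
under eq_bigr => psi _ do rewrite ffunE.
move=> ->; apply: eq_bigr => phi _.
rewrite sum_nat_const card_ffun_on card_ord mulnC /deg.
by case: eqP => [->|]; rewrite ?mul0n.
Qed.

End Pendant.

Lemma sum_root (H : sgraph) (z : H) (V : finType) (A : rel V) (g : V -> nat) :
  \sum_(f in homs H A) g (f z) = \sum_v rhom z A v * g v.
Proof.
rewrite (partition_big (fun f : {ffun H -> V} => f z) predT) //=.
apply: eq_bigr => v _; rewrite /rhom -sum1_card big_distrl /=.
apply: eq_big => [f|f /andP[_ /eqP ->]]; last by rewrite mul1n.
by rewrite [in RHS]inE.
Qed.

Section Doubling.
Variables (I : seq nat) (F : lgraph) (V : finType) (A : rel V).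

Lemma db_inj1_subproof (x : F) : glued I (x, ~~ glued I x).1 ==> ~~ (x, ~~ glued I x).2.
Proof. by rewrite negbK implybb. Qed.
(** The second copy of F in its doubling; it shares the glued vertices with the
    first copy [db_inj0]. *)
Definition db_inj1 (x : F) : db_vertex I F := Sub (x, ~~ glued I x) (db_inj1_subproof x).

Lemma db_inj1_glued x : glued I x -> db_inj1 x = db_inj0 I x.
Proof. by move=> gx; apply/val_inj; rewrite /= gx. Qed.

Definition agree (p q : {ffun F -> V}) := [forall x, glued I x ==> (p x == q x)].

Let res0 (psi : {ffun db I F -> V}) : {ffun F -> V} := [ffun x => psi (db_inj0 I x)].
Let res1 (psi : {ffun db I F -> V}) : {ffun F -> V} := [ffun x => psi (db_inj1 x)].
Let join (p : {ffun F -> V} * {ffun F -> V}) : {ffun db I F -> V} :=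
  [ffun u : db I F => if (val u).2 then p.2 (val u).1 else p.1 (val u).1].

(** A homomorphism of the doubling is a pair of homomorphisms of F that coincide on
    the glued vertices. An edge between glued vertices is tested in both copies, which
    is harmless because being a homomorphism is a conjunction. *)
Lemma sum_db (g : {ffun F -> V} -> {ffun F -> V} -> nat) :
  \sum_(psi in homs (db I F) A) g (res0 psi) (res1 psi) =
  \sum_(p in homs F A) \sum_(q in homs F A | agree p q) g p q.
Proof.
have res0K p q : agree p q -> res0 (join (p, q)) = p.
  by move=> _; apply/ffunP => x; rewrite !ffunE.
have res1K p q : agree p q -> res1 (join (p, q)) = q.
  move=> /forallP a; apply/ffunP => x; rewrite !ffunE /=.
  by have := a x; case: (glued I x) => //= /eqP.
have joinK psi : join (res0 psi, res1 psi) = psi.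
  apply/ffunP => u; rewrite ffunE /= !ffunE.
  by case: u => -[x []] /= h; congr (psi _); apply/val_inj => //=; case: (glued I x) h.
have res_agree psi : agree (res0 psi) (res1 psi).
  by apply/forallP => x; apply/implyP => gx; rewrite !ffunE db_inj1_glued.
have join_hom p q : agree p q -> (join (p, q) \in homs (db I F) A) =
    (p \in homs F A) && (q \in homs F A).
  move=> a; apply/idP/andP => [/homsP h|[/homsP hp /homsP hq]].
    split; apply/homsP => x y xy.
      have := h (db_inj0 I x) (db_inj0 I y); rewrite !ffunE /=; apply.
      by rewrite /db_adj /= xy eqxx !orbT.
    have join1 w : join (p, q) (db_inj1 w) = q w by have /ffunP/(_ w) := res1K _ _ a; rewrite ffunE.
    have := h (db_inj1 x) (db_inj1 y); rewrite !join1; apply.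
    by rewrite /= /db_adj /= xy; case: (glued I x); case: (glued I y).
  have e x : glued I x -> p x = q x by move: a => /forallP/(_ x)/implyP h /h /eqP.
  apply/homsP => -[[x b] hx] [[y c] hy]; rewrite !ffunE /= /db_adj /= => /andP[xy].
  case: b hx => /= hx; case: c hy => /= hy; rewrite ?orbF => gl.
  - exact: hq.
  - by move: gl hx; case: (boolP (glued I x)) => //= _ /e ->; rewrite hq.
  - by move: gl hy; case: (boolP (glued I y)) => //=; rewrite orbF => _ /e -> _; rewrite hq.
  - exact: hp.
rewrite pair_big_dep /= (reindex_onto join (fun psi => (res0 psi, res1 psi))); last first.
  by move=> psi _; exact: joinK.
apply: eq_big => [[p q]|[p q] /andP[_ /eqP E]]; last first.
  have E1 : res0 (join (p, q)) = p := congr1 fst E.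
  have E2 : res1 (join (p, q)) = q := congr1 snd E.
  by rewrite E1 E2.
apply/andP/and3P => [[h /eqP E]|[/= hp hq a]].
  have E1 : res0 (join (p, q)) = p := congr1 fst E.
  have E2 : res1 (join (p, q)) = q := congr1 snd E.
  have a : agree p q by have := res_agree (join (p, q)); rewrite E1 E2.
  by move: h; rewrite join_hom // => /andP[].
by rewrite join_hom // hp hq res0K // res1K.
Qed.
End Doubling.

Section DoublingCounts.
Variables (V : finType) (A : rel V).
Hypothesis Asym : symmetric A.

Definition codeg (x y : V) : nat := #|[pred u | A x u && A y u]|.

Lemma codegxx x : codeg x x = deg A x.
Proof. by apply: eq_card => u; rewrite !inE andbb. Qed.

Section Root.
Variables (F : lgraph) (z : F).
Hypothesis labz : lab F 0 = Some z.

Lemma glued0 x : glued [:: 0] x = (x == z).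
Proof. by rewrite /glued /= labz orbF eq_sym. Qed.

Lemma lab_db0 : lab (db [:: 0] F) 0 = Some (db_inj0 [:: 0] z).
Proof. exact: (congr1 (omap (@db_inj0 [:: 0] F)) labz). Qed.

Lemma rhom_db0 v : @rhom (db [:: 0] F) (db_inj0 [:: 0] z) V A v = rhom z A v ^ 2.
Proof.
rewrite rhomE.
have := sum_db [:: 0] A (fun (p q : {ffun F -> V}) => (p z == v) : nat).
under eq_bigr => psi _ do rewrite ffunE.
move=> ->; rewrite -mulnn {1}rhomE big_distrl /=; apply: eq_bigr => p _.
case: eqP => [pv|]; last by rewrite big1.
rewrite mul1n sum_nat_const muln1 /rhom; apply: eq_card => q; rewrite [in RHS]inE [in LHS]unfold_in.
congr (_ && _); rewrite /agree; apply/forallP/eqP => [/(_ z)|qz x].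
  by rewrite glued0 eqxx pv => /eqP.
by rewrite glued0; apply/implyP => /eqP ->; rewrite pv qz.
Qed.

(** If the k pendant vertices are glued, each of them goes to a common neighbour of
    the images of the two roots. The relation r says what the gluing imposes on the
    roots: equality if they are glued too, nothing otherwise. *)
Lemma card_homs_db_pendant k I (r : rel V) :
  (forall p q : {ffun pendant k F -> V}, agree I p q =
     r (p (inl z)) (q (inl z)) && [forall j, p (inr j) == q (inr j)]) ->
  #|homs (db I (pendant k F)) A| =
  \sum_v rhom z A v * \sum_w rhom z A w * (r v w * codeg v w ^ k).
Proof.
move=> agreeE; rewrite -sum1_card (sum_db I A (fun _ _ => 1)).
under eq_bigr => p _ do rewrite big_mkcondr /=.
pose G (f : {ffun F -> V}) (h : {ffun 'I_k -> V}) :=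
  \sum_(f' in homs F A) \sum_(h' in ffun_on (A (f' z))) (r (f z) (f' z) && (h == h')).
transitivity (\sum_(f in homs F A) \sum_(h in ffun_on (A (f z))) G f h).
  rewrite -(sum_pendant labz Asym); apply: eq_bigr => p _.
  rewrite /G -(sum_pendant labz Asym); apply: eq_bigr => q _.
  rewrite agreeE !ffunE; set b := [forall j, _]; set c := (_ == _).
  have -> : c = b; last by case: (_ && _).
  apply/eqP/forallP => [/ffunP h j|h].
    by have := h j; rewrite !ffunE => ->.
  by apply/ffunP => j; rewrite !ffunE; apply/eqP.
rewrite -(sum_root z A (fun v => \sum_w rhom z A w * (r v w * codeg v w ^ k))).
apply: eq_bigr => f _; rewrite -(sum_root z A (fun w => r (f z) w * codeg (f z) w ^ k)).
rewrite exchange_big /=; apply: eq_bigr => f' _.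
rewrite exchange_big /=.
transitivity (\sum_(h | h \in @ffun_on_mem 'I_k V (mem [pred u | A (f z) u && A (f' z) u]))
    nat_of_bool (r (f z) (f' z))).
  rewrite big_mkcond [RHS]big_mkcond; apply: eq_bigr => h _ /=.
  have -> : (h \in @ffun_on_mem 'I_k V (mem [pred u | A (f z) u && A (f' z) u])) =
     (h \in ffun_on (A (f z))) && (h \in ffun_on (A (f' z))).
    apply/ffun_onP/andP => [H|[/ffun_onP h1 /ffun_onP h2] j].
      by split; apply/ffun_onP => j; have := H j; rewrite inE => /andP[].
    by rewrite inE; apply/andP; split; [apply: h1|apply: h2].
  case: (boolP (h \in ffun_on (A (f' z)))) => hf'; rewrite ?andbF ?andbT //.
  case: (boolP (h \in ffun_on (A (f z)))) => hf; last first.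
    rewrite big1 // => h' hh'; have /negPf-> : h' != h by apply: contraNneq hf => <-.
    by rewrite andbF.
  rewrite (bigD1 h) //= eqxx andbT big1 ?addn0 // => h' /andP[_ /negPf ->].
  by rewrite andbF.
by rewrite sum_nat_const card_ffun_on card_ord mulnC.
Qed.

Lemma lab_pendant0 k : lab (pendant k F) 0 = Some (inl z).
Proof. by rewrite /= labz. Qed.

Lemma lab_pendantS k j (jk : j < k) : lab (pendant k F) j.+1 = Some (inr (Ordinal jk)).
Proof. by rewrite /= insubT. Qed.

Lemma glued01 (u : pendant 1 F) :
  glued [:: 0; 1] u = if u is inl x then x == z else true.
Proof.
rewrite /glued /has lab_pendant0 lab_pendantS.
by case: u => [x|j]; rewrite /eq_op /= ?orbF ?[j]ord1 // eq_sym.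
Qed.

Lemma glued12 (u : pendant 2 F) :
  glued [:: 1; 2] u = if u is inl x then false else true.
Proof.
rewrite /glued /has !lab_pendantS.
by case: u => [x|[[|[|//]] j]]; rewrite /eq_op.
Qed.

Lemma card_homs_db01 :
  #|homs (db [:: 0; 1] (pendant 1 F)) A| = \sum_v rhom z A v ^ 2 * deg A v.
Proof.
rewrite (@card_homs_db_pendant 1 _ (fun v w => v == w)) => [|p q].
  apply: eq_bigr => v _; rewrite (bigD1 v) //= eqxx mul1n expn1 codegxx big1 ?addn0.
    by rewrite mulnA mulnn.
  by move=> w; rewrite eq_sym => /negPf ->; rewrite !mul0n muln0.
apply/forallP/andP => [h|[h1 /forallP h2] u].
  split; first by have := h (inl z); rewrite glued01 eqxx.
  by apply/forallP => j; have := h (inr j); rewrite glued01.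
by apply/implyP; rewrite glued01; case: u => [x /eqP ->|j _].
Qed.

Lemma card_homs_db12 :
  #|homs (db [:: 1; 2] (pendant 2 F)) A| =
  \sum_v rhom z A v * \sum_w rhom z A w * codeg v w ^ 2.
Proof.
rewrite (@card_homs_db_pendant 2 _ (fun v w => true)) => [|p q].
  by apply: eq_bigr => v _; congr (_ * _); apply: eq_bigr => w _; rewrite mul1n.
apply/forallP/forallP => [h j|h u].
  by have := h (inr j); rewrite glued12.
by apply/implyP; rewrite glued12; case: u.
Qed.
End Root.

End DoublingCounts.

(** * Walks and even cycles *)

Section Walks.
Variables (V : finType) (A : rel V).
Hypothesis Asym : symmetric A.

Fixpoint walks (k : nat) (x y : V) : nat :=
  if k is k'.+1 then \sum_u A x u * walks k' u y else x == y.

Lemma walks1 x y : walks 1 x y = A x y.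
Proof.
by rewrite /= (bigD1 y) //= eqxx muln1 big1 ?addn0 // => u /negPf ->; rewrite muln0.
Qed.

Lemma walksD j k x y : walks (j + k) x y = \sum_u walks j x u * walks k u y.
Proof.
elim: j x => [|j IH] x /=.
  by rewrite (bigD1 x) //= eqxx mul1n big1 ?addn0 // => u; rewrite eq_sym => /negPf ->.
under eq_bigr => u _ do rewrite IH big_distrr /=.
rewrite exchange_big /=; apply: eq_bigr => w _; rewrite big_distrl /=.
by apply: eq_bigr => u _; rewrite mulnA.
Qed.

Lemma walks_sym k x y : walks k x y = walks k y x.
Proof.
elim: k x y => [|k IH] x y; first by rewrite /= eq_sym.
rewrite -[in RHS]addn1 walksD [LHS]/=; apply: eq_bigr => u _.
by rewrite walks1 mulnC IH Asym.
Qed.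

Lemma codeg_walks x y : codeg A x y = walks 2 x y.
Proof.
rewrite /codeg -sum1_card big_mkcond /=; apply: eq_bigr => u _.
by have /= -> := walks1 u y; rewrite inE [A u y]Asym; case: (A x u); case: (A y u).
Qed.

Lemma sum_tuple_cons (W : finType) k (g : k.+1.-tuple W -> nat) :
  \sum_t g t = \sum_u \sum_(t : k.-tuple W) g [tuple of u :: t].
Proof.
rewrite pair_big /= (reindex (fun p : W * k.-tuple W => [tuple of p.1 :: p.2])) //.
exists (fun t => (thead t, [tuple of behead t])) => [[u t] _|t _].
  by congr pair; apply: val_inj.
by rewrite [RHS]tuple_eta; apply: val_inj.
Qed.

Lemma sum_path k x y :
  \sum_(t : k.-tuple V) path A x (rcons t y) = walks k.+1 x y.
Proof.
elim: k x => [|k IH] x.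
  rewrite walks1 (big_pred1 [tuple]) /= ?andbT // => t.
  by rewrite [t]tuple0; apply/esym/eqP.
rewrite sum_tuple_cons [RHS]/=; apply: eq_bigr => u _.
rewrite -/(walks k.+1 u y) -IH big_distrr /=; apply: eq_bigr => t _.
by rewrite mulnb.
Qed.

Lemma cycle_tupleP k (f : 'I_k.+1 -> V) :
  reflect (forall i, A (f i) (f (ordS i))) (cycle A [tuple f i | i < k.+1]).
Proof.
set t := [tuple _ | _ < _]; have -> : cycle A t = path A (thead t) (rcons (behead t) (thead t)).
  by rewrite {1}[t]tuple_eta.
have nthE i (ik : i < k.+1) : nth (f ord0) (thead t :: behead t) i = f (Ordinal ik).
  have -> : thead t :: behead t = t by rewrite [in RHS](tuple_eta t).
  by rewrite -(tnth_nth _ t (Ordinal ik)) tnth_mktuple.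
have sz : size (behead t) = k by rewrite size_behead size_tuple.
have nextE i (ik : i < k.+1) :
    nth (f ord0) (rcons (behead t) (thead t)) i = f (ordS (Ordinal ik)).
  rewrite nth_rcons sz; case: ltngtP => [lt|gt|eq].
  - rewrite -[nth _ _ i]/(nth (f ord0) (thead t :: behead t) i.+1).
    have lt' : i.+1 < k.+1 by [].
    by rewrite (nthE _ lt'); congr f; apply: val_inj => /=; rewrite modn_small.
  - by have := leq_trans gt ik; rewrite ltnn.
  - rewrite -[thead t]/(nth (f ord0) (thead t :: behead t) 0) (nthE 0 isT).
    by congr f; apply: val_inj => /=; rewrite eq modnn.
apply: (iffP (pathP (f ord0))) => [h [i ik]|h i].
  have := h i; rewrite size_rcons sz => /(_ ik).
  by rewrite -rcons_cons nth_rcons /= sz ik nthE nextE.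
rewrite size_rcons sz => ik.
by rewrite -rcons_cons nth_rcons /= sz ik nthE nextE; apply: h.
Qed.

(** The images read around the cycle form a closed walk. *)
Lemma card_homs_cycle k : 1 < k -> #|homs (cycle_graph k) A| = \sum_x walks k x x.
Proof.
case: k => [//|[//|k]] _.
transitivity (\sum_(t : k.+2.-tuple V) cycle A t); last first.
  rewrite sum_tuple_cons; apply: eq_bigr => x _.
  by rewrite -sum_path; apply: eq_bigr => t _.
rewrite -sum1_card big_mkcond.
rewrite (reindex (fun t : k.+2.-tuple V =>
  [ffun i => tnth t i] : {ffun cycle_graph k.+2 -> V})); last first.
  exists (fun f : {ffun cycle_graph k.+2 -> V} => [tuple f i | i < k.+2]) => [t _|f _].
    by apply: eq_from_tnth => i; rewrite tnth_mktuple ffunE.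
  by apply/ffunP => i; rewrite ffunE tnth_mktuple.
apply: eq_bigr => t _.
have {2}-> : t = [tuple tnth t i | i < k.+2].
  by apply: eq_from_tnth => i; rewrite tnth_mktuple.
have ordS_neq (i : 'I_k.+2) : i != ordS i.
  rewrite -val_eqE /=; have := ltn_ord i; rewrite leq_eqVlt => /orP[/eqP e|lt].
    by rewrite e modnn; lia.
  by rewrite modn_small //; lia.
set b := (_ \in _); set c := cycle _ _; have -> : b = c; last by case: c.
apply/idP/idP => [/homsP h|/cycle_tupleP h];
  [apply/cycle_tupleP => i|apply/homsP => i j]; last first.
  rewrite !ffunE => /andP[_ /orP[/eqP <-|/eqP <-]]; first exact: h.
  by rewrite Asym; apply: h.
by have := h i (ordS i); rewrite !ffunE; apply; rewrite /= /cycle_adj eqxx ordS_neq.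
Qed.

(** Two opposite vertices cut the cycle into two walks with the same ends. *)
Lemma card_homs_cycle_double k : 0 < k ->
  #|homs (cycle_graph (2 * k)) A| = \sum_x \sum_y walks k x y ^ 2.
Proof.
move=> k0; rewrite card_homs_cycle; last by lia.
apply: eq_bigr => x _; rewrite mul2n -addnn walksD; apply: eq_bigr => y _.
by rewrite [walks k y x]walks_sym mulnn.
Qed.

End Walks.

(** * Counting edges *)

Section EdgeCounts.
Variable G : sgraph.

(** An orientation of the edges, so that products over edges have no repeated factor. *)
Definition fwd : {set G * G} := [set p | adj p.1 p.2 & enum_rank p.1 < enum_rank p.2].

(** Edges are counted through ordered pairs, because sums over the vertices of the
    constructions split into sums over the vertices of F. *)
Definition arcs : nat := \sum_(x : G) \sum_(y : G) adj x y.

Lemma card_fwd : #|fwd| = #|edges G|.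
Proof.
have -> : edges G = [set [set p.1; p.2] | p in fwd].
  apply/setP => e; rewrite inE; apply/existsP/imsetP.
    move=> [x /existsP[y /andP[xy /eqP ->]]].
    have [lt|gt|/val_inj/enum_rank_inj eq] := ltngtP (enum_rank x) (enum_rank y).
    - by exists (x, y) => //; rewrite inE xy.
    - by exists (y, x); rewrite ?inE /= 1?adj_sym ?xy //= finset.setUC.
    - by rewrite eq adj_irrefl in xy.
  move=> [[x y]]; rewrite inE /= => /andP[xy _] ->; exists x; apply/existsP; exists y.
  by rewrite xy eqxx.
rewrite card_in_imset // => -[x y] [x' y']; rewrite !inE /= => /andP[xy lt] /andP[xy' lt'] /setP E.
have /set2P[ex|ex] : x \in [set x'; y'] by rewrite -E set21.
  have /set2P[ey|ey] : y \in [set x'; y'] by rewrite -E set22.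
    by rewrite ex ey ltnn in lt.
  by rewrite ex ey.
have /set2P[ey|ey] : y \in [set x'; y'] by rewrite -E set22.
  by rewrite ex ey ltnNge ltnW in lt.
by rewrite ex ey ltnn in lt.
Qed.

Lemma arcsE : arcs = 2 * #|edges G|.
Proof.
rewrite -card_fwd mul2n -addnn.
pose B := [set p : G * G | adj p.1 p.2 & enum_rank p.2 < enum_rank p.1].
have cB : #|B| = #|fwd|.
  have swK : involutive (fun p : G * G => (p.2, p.1)) by case.
  rewrite -(card_imset fwd (inv_inj swK)); apply: eq_card => -[x y].
  apply/idP/imsetP => [|[[x' y'] h [-> ->]]].
    by rewrite inE /= => /andP[xy lt]; exists (y, x); rewrite // inE /= adj_sym xy.
  by move: h; rewrite !inE /= adj_sym.
rewrite -{1}cB -!sum1_card /arcs pair_big /= [X in X + _]big_mkcond [X in _ + X]big_mkcond.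
rewrite -big_split /=; apply: eq_bigr => -[x y] _; rewrite !inE /=.
case: ltngtP => [||/val_inj/enum_rank_inj ->]; rewrite ?andbF ?andbT ?adj_irrefl //.
by case: (adj x y).
Qed.

End EdgeCounts.

Section ConstructionCounts.

Lemma arcs_pendant k (F : lgraph) (z : F) : lab F 0 = Some z ->
  arcs (pendant k F) = arcs F + 2 * k.
Proof.
move=> labz; rewrite /arcs big_sumType /=.
under eq_bigr => x _ do rewrite big_sumType /=.
under [X in _ + X]eq_bigr => x _ do rewrite big_sumType /=.
rewrite big_split /= -addnA; congr (_ + _).
rewrite (bigD1 z) //= [X in _ + X + _]big1 => [|x xz]; last first.
  by rewrite big1 // => j _; rewrite labz; case: eqP => // -[e]; rewrite e eqxx in xz.
rewrite sum_nat_const card_ord labz eqxx muln1 addn0 mul2n -addnn; congr (_ + _).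
rewrite (eq_bigr (fun _ => 1)); first by rewrite sum_nat_const card_ord muln1.
move=> j _; rewrite [X in _ + X]big1 // addn0 (bigD1 z) //= eqxx big1 // => x xz.
by case: eqP => // -[e]; rewrite e eqxx in xz.
Qed.

Lemma card_pendant k (F : lgraph) : #|pendant k F| = #|F| + k.
Proof. by rewrite /= card_sum card_ord. Qed.

Lemma sum_db_vertex (I : seq nat) (F : lgraph) (g : F -> bool -> nat) :
  \sum_(u : db I F) g (val u).1 (val u).2 =
  \sum_x (g x false + ~~ glued I x * g x true).
Proof.
rewrite -(big_sub (fun u : F * bool => glued I u.1 ==> ~~ u.2) (fun u => g u.1 u.2)).
rewrite -(pair_big_dep xpredT (fun x b => glued I x ==> ~~ b) (fun x b => g x b)) /=.
apply: eq_bigr => x _; rewrite big_mkcond big_bool /= implybF addnC; congr (_ + _).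
  by rewrite implybT.
by case: glued; rewrite ?mul1n.
Qed.

Lemma card_db I (F : lgraph) : #|db I F| + \sum_(x : F) glued I x = 2 * #|F|.
Proof.
have := sum_db_vertex I (fun (x : F) (b : bool) => 1); rewrite sum1_card => ->.
rewrite -big_split /= mulnC -sum_nat_const.
by apply: eq_bigr => x _; case: glued.
Qed.

(** An arc has two images in the doubling, unless both of its ends are glued. *)
Lemma arcs_db I (F : lgraph) :
  arcs (db I F) + \sum_(x : F) \sum_(y : F) (adj x y && (glued I x && glued I y)) =
  2 * arcs F.
Proof.
pose g (x : F) (b : bool) (y : F) (c : bool) : nat :=
  adj x y && [|| glued I x, glued I y | b == c].
have -> : arcs (db I F) = \sum_(u : db I F)
    (fun x b => \sum_(v : db I F) g x b (val v).1 (val v).2) (val u).1 (val u).2.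
  by apply: eq_bigr => -[[x b] ?] _; apply: eq_bigr => -[[y c] ?] _.
rewrite (sum_db_vertex I (fun x b => \sum_(v : db I F) g x b (val v).1 (val v).2)).
rewrite -big_split /= big_distrr /=; apply: eq_bigr => x _.
rewrite !(sum_db_vertex I (g x _)) !big_distrr /= -!big_split /=; apply: eq_bigr => y _.
rewrite /g.
by case: (adj x y); case: (glued I x); case: (glued I y).
Qed.

End ConstructionCounts.

(** * The members of the three families *)

Section RootedCounts.
Variables (F : lgraph) (z : F).
Hypothesis labz : lab F 0 = Some z.

Lemma arcs_db0 : arcs (db [:: 0] F) = 2 * arcs F.
Proof.
rewrite -(arcs_db [:: 0]) [X in _ + X]big1 ?addn0 // => x _; rewrite big1 // => y _.
rewrite !(glued0 labz); case: eqP => [->|_]; last by rewrite andbF.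
by case: eqP => [->|_]; rewrite ?adj_irrefl ?andbF.
Qed.

Lemma card_db0 : #|db [:: 0] F| + 1 = 2 * #|F|.
Proof.
rewrite -(card_db [:: 0]); congr (_ + _).
under eq_bigr => x _ do rewrite (glued0 labz).
by rewrite (bigD1 z) //= eqxx big1 // => x /negPf ->.
Qed.

Lemma arcs_db12 : arcs (db [:: 1; 2] (pendant 2 F)) = 2 * arcs F + 8.
Proof.
have := arcs_db [:: 1; 2] (pendant 2 F); rewrite (arcs_pendant _ labz).
rewrite big1 => [|x _]; first by lia.
rewrite big1 // => y _; rewrite !glued12.
by case: x => [x|i]; case: y => [y|j]; rewrite ?andbF.
Qed.

Lemma card_db12 : #|db [:: 1; 2] (pendant 2 F)| = 2 * #|F| + 2.
Proof.
have := card_db [:: 1; 2] (pendant 2 F); rewrite card_pendant.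
under eq_bigr => x _ do rewrite glued12.
by rewrite big_sumType /= big1 // sum_nat_const card_ord; lia.
Qed.

Lemma arcs_db01 : arcs (db [:: 0; 1] (pendant 1 F)) = 2 * arcs F + 2.
Proof.
have := arcs_db [:: 0; 1] (pendant 1 F); rewrite (arcs_pendant _ labz).
under eq_bigr => x _ do under eq_bigr => y _ do rewrite !(glued01 labz).
suff -> : \sum_(x : pendant 1 F) \sum_(y : pendant 1 F)
  (adj x y && ((match x with inl x => x == z | _ => true end) &&
     (match y with inl x => x == z | _ => true end))) = 2 by lia.
rewrite big_sumType /= big_ord1 (bigD1 z) //= [X in _ + X + _]big1 => [|x xz]; last first.
  by rewrite big1 // => y _; rewrite (negPf xz) andbF.
rewrite !big_sumType /= !big_ord1 /= !addn0 labz eqxx /=.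
rewrite big1 => [|x _]; last by case: eqP => [->|]; rewrite ?adj_irrefl ?andbF.
rewrite (bigD1 z) //= !eqxx big1 // => x xz.
by rewrite (negPf xz) andbF.
Qed.

Lemma card_db01 : #|db [:: 0; 1] (pendant 1 F)| = 2 * #|F|.
Proof.
have := card_db [:: 0; 1] (pendant 1 F); rewrite card_pendant.
under eq_bigr => x _ do rewrite (glued01 labz).
rewrite big_sumType /= big_ord1 (bigD1 z) //= eqxx [X in _ + X + _]big1; first by lia.
by move=> x /negPf ->.
Qed.

End RootedCounts.

Lemma card_edges_arcs (G : sgraph) n : arcs G = 2 * n -> #|edges G| = n.
Proof. by rewrite arcsE; lia. Qed.

Lemma card_edges_cycle k : 2 < k -> #|edges (cycle_graph k)| = k.
Proof.
move=> k2; apply: card_edges_arcs; rewrite /arcs.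
transitivity (\sum_(i < k) \sum_(j < k) ((ordS i == j) + (ordS j == i))).
  apply: eq_bigr => i _; apply: eq_bigr => j _.
  rewrite [adj i j]/(cycle_adj i j) /cycle_adj -!val_eqE /=.
  have := ltn_ord i; have := ltn_ord j; rewrite leq_eqVlt => /orP[/eqP ej|lj].
    rewrite leq_eqVlt => /orP[/eqP ei|li]; rewrite ?ej ?ei ?modnn ?modn_small //; lia.
  rewrite leq_eqVlt => /orP[/eqP ei|li]; rewrite ?ei ?modnn ?modn_small //; lia.
have sum_eq i : \sum_(j < k) (ordS i == j) = 1.
  by rewrite (bigD1 (ordS i)) //= eqxx big1 // => j; rewrite eq_sym => /negPf ->.
under eq_bigr => i _ do rewrite big_split /= sum_eq.
rewrite big_split /= sum_nat_const card_ord muln1 exchange_big /=.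
under [X in _ + X]eq_bigr => i _ do rewrite sum_eq.
by rewrite sum_nat_const card_ord; lia.
Qed.

Lemma card_edges_edge_graph : #|edges edge_graph| = 1.
Proof. by apply: card_edges_arcs; rewrite /arcs !big_bool. Qed.

Lemma card_homs_edge_graph (V : finType) (A : rel V) : symmetric A ->
  #|homs edge_graph A| = \sum_v deg A v.
Proof.
move=> Asym; under eq_bigr => v _ do rewrite degE.
pose mk (p : V * V) : {ffun edge_graph -> V} := [ffun b : bool => if b then p.1 else p.2].
have mk_hom x y : (mk (x, y) \in homs edge_graph A) = A x y.
  apply/idP/idP => [/homsP h|h]; first by have := h true false isT; rewrite !ffunE.
  by apply/homsP => -[] [] //= _; rewrite !ffunE // Asym.
rewrite pair_big /= -sum1_card big_mkcond (reindex mk); last first.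
  exists (fun f : {ffun edge_graph -> V} => (f true, f false)) => [[x y] _|f _].
    by rewrite !ffunE.
  by apply/ffunP => -[]; rewrite ffunE.
by apply: eq_bigr => -[x y] _; rewrite mk_hom; case: (A x y).
Qed.

Section Members.
Variables (T : sgraph) (z : T).
Let T0 := rooted z.
Let N := #|T|.
Let M := #|edges T|.
Definition T' := pendant 1 T0.
(** The doubled graph of each family: two copies of T' sharing an edge in the first
    one, a C_4 with copies of T, respectively of T with pendant vertices, at two
    opposite vertices in the other two. *)
Definition edge_double := db [:: 0; 1] (pendant 1 T0).
Definition C4_quad := db [:: 1; 2] (pendant 2 (db [:: 0] (db [:: 0] T0))).
Definition C4_pendants := db [:: 1; 2] (pendant 2 (db [:: 0] (pendant #|T| T0))).

Lemma lab_rooted : lab T0 0 = Some z. Proof. by []. Qed.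

Lemma edges_T' : #|edges T'| = M + 1.
Proof. by apply: card_edges_arcs; rewrite (arcs_pendant 1 lab_rooted) arcsE /M /=; lia. Qed.
Lemma card_T' : #|T'| = N + 1.
Proof. by rewrite card_pendant. Qed.
Lemma edges_edge_double : #|edges edge_double| = 2 * M + 1.
Proof. by apply: card_edges_arcs; rewrite (arcs_db01 lab_rooted) arcsE /M /=; lia. Qed.
Lemma card_edge_double : #|edge_double| = 2 * N.
Proof. by rewrite (card_db01 lab_rooted). Qed.
Lemma edges_C4_quad : #|edges C4_quad| = 8 * M + 4.
Proof.
apply: card_edges_arcs; rewrite (arcs_db12 (lab_db0 (lab_db0 lab_rooted))).
by rewrite (arcs_db0 (lab_db0 lab_rooted)) (arcs_db0 lab_rooted) arcsE /M /=; lia.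
Qed.
Lemma card_C4_quad : #|C4_quad| + 4 = 8 * N.
Proof.
rewrite card_db12.
have := card_db0 (lab_db0 lab_rooted); have := card_db0 lab_rooted.
by rewrite /N /=; lia.
Qed.
Lemma edges_C4_pendants : #|edges C4_pendants| = 4 * M + 4 * N + 4.
Proof.
apply: card_edges_arcs; rewrite (arcs_db12 (lab_db0 (lab_pendant0 lab_rooted _))).
by rewrite (arcs_db0 (lab_pendant0 lab_rooted _)) (arcs_pendant _ lab_rooted) arcsE /M /N /=; lia.
Qed.
Lemma card_C4_pendants : #|C4_pendants| = 8 * N.
Proof.
rewrite card_db12.
have := card_db0 (lab_pendant0 lab_rooted #|T|); rewrite card_pendant /N.
have : 0 < #|T| by apply/card_gt0P; exists z.
by rewrite /=; lia.
Qed.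

Section HomCounts.
Variables (V : finType) (A : rel V).
Hypothesis Asym : symmetric A.
Let r := rhom z A.
Let d := deg A.

Lemma hom_T : #|homs T A| = \sum_v r v. Proof. exact: card_homs_rhom. Qed.
Lemma hom_T' : #|homs T' A| = \sum_v r v * d v.
Proof.
rewrite (card_homs_rhom (inl z : T')); apply: eq_bigr => v _.
by rewrite (rhom_pendant 1 lab_rooted Asym) expn1.
Qed.
Lemma hom_edge_double : #|homs edge_double A| = \sum_v r v ^ 2 * d v.
Proof. exact: (card_homs_db01 Asym lab_rooted). Qed.
Lemma hom_C4_quad : #|homs C4_quad A| = \sum_v r v ^ 4 * \sum_w r w ^ 4 * walks A 2 v w ^ 2.
Proof.
rewrite (card_homs_db12 Asym (lab_db0 (lab_db0 lab_rooted))).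
pose z1 : db [:: 0] T0 := @db_inj0 [:: 0] T0 z.
pose z2 : db [:: 0] (db [:: 0] T0) := @db_inj0 [:: 0] (db [:: 0] T0) z1.
have rE v : rhom z2 A v = r v ^ 4.
  by rewrite (rhom_db0 _ (lab_db0 lab_rooted)) (rhom_db0 _ lab_rooted) -expnM.
apply: eq_bigr => v _; rewrite rE; congr (_ * _); apply: eq_bigr => w _.
by rewrite rE codeg_walks.
Qed.
Lemma hom_C4_pendants : #|homs C4_pendants A| =
  \sum_v (r v * d v ^ N) ^ 2 * \sum_w (r w * d w ^ N) ^ 2 * walks A 2 v w ^ 2.
Proof.
rewrite (card_homs_db12 Asym (lab_db0 (lab_pendant0 lab_rooted _))).
pose z1 : db [:: 0] (pendant N T0) := @db_inj0 [:: 0] (pendant N T0) (inl z).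
have rE v : rhom z1 A v =
   (r v * d v ^ N) ^ 2.
  by rewrite (rhom_db0 _ (lab_pendant0 lab_rooted _)) (rhom_pendant _ lab_rooted Asym).
apply: eq_bigr => v _; rewrite rE; congr (_ * _); apply: eq_bigr => w _.
by rewrite rE codeg_walks.
Qed.
End HomCounts.
End Members.

(** * Resampling one vertex *)

Section Resampling.
Variables (H V : finType).

Definition upd (f : {ffun H -> V}) x a := [ffun y => if y == x then a else f y].

(** The involution that exchanges the new value a with the old value f x. *)
Lemma big_upd (R : Type) (idx : R) (op : Monoid.com_law idx) (x : H)
    (g : {ffun H -> V} -> R) :
  \big[op/idx]_f \big[op/idx]_(a : V) g (upd f x a) = \big[op/idx]_f \big[op/idx]_(a : V) g f.
Proof.
rewrite !pair_big /=.
pose s (p : {ffun H -> V} * V) := (upd p.1 x p.2, p.1 x).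
have sK : involutive s.
  case=> f a; rewrite /s /=; congr pair; last by rewrite ffunE eqxx.
  by apply/ffunP => y; rewrite !ffunE; case: eqP => // ->.
by rewrite [RHS](reindex_inj (inv_inj sK)).
Qed.

Lemma card_collision (x y : H) : x != y ->
  #|[set f : {ffun H -> V} | f x == f y]| = #|V| ^ #|H|.-1.
Proof.
move=> xy; set S := [set f | _].
have H1 : 1 < #|H| by apply/card_gt1P; exists x, y.
have E : #|V| ^ #|H| = #|S| * #|V|.
  transitivity (\sum_(f : {ffun H -> V}) \sum_(a : V) ((f \in S) : nat)); last first.
    rewrite -[X in X * _]sum1_card big_distrl [RHS]big_mkcond /=.
    by apply: eq_bigr => f _; rewrite sum_nat_const mulnC; case: (f \in S).
  rewrite -(big_upd addn y (fun f => (f \in S) : nat)) -card_ffun -sum1_card.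
  apply: eq_bigr => f _; rewrite (bigD1 (f x)) //= big1 ?addn0.
    by rewrite inE !ffunE eqxx (negPf xy) eqxx.
  by move=> a ax; rewrite inE !ffunE eqxx (negPf xy) eq_sym (negPf ax).
case: (posnP #|V|) => [V0|Vp].
  rewrite V0 exp0n; last by lia.
  apply/eqP; rewrite cards_eq0; apply/eqP/setP => f.
  by have := enum_rank (f x); rewrite V0 => -[].
by apply/eqP; rewrite -(eqn_pmul2r Vp) -E -expnSr prednK //; apply: ltnW.
Qed.
End Resampling.

(** * Connected non-bipartite graphs *)

Definition no_isolated (G : sgraph) := forall x : G, exists y, adj x y.

Lemma no_isolated_db I (F : lgraph) : no_isolated F -> no_isolated (db I F).
Proof.
move=> iso [[x b] h]; have [y xy] := iso x.
case: (boolP (glued I y)) => gy.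
  by exists (db_inj0 I y); rewrite /= /db_adj /= xy gy orbT.
have hy : glued I (y, b).1 ==> ~~ (y, b).2 by rewrite (negPf gy).
by exists (Sub (y, b) hy); rewrite /= /db_adj /= xy eqxx !orbT.
Qed.

Lemma no_isolated_pendant k (F : lgraph) z : lab F 0 = Some z ->
  no_isolated F -> no_isolated (pendant k F).
Proof.
move=> labz iso [x|j]; last by exists (inl z); rewrite /= labz.
by have [y xy] := iso x; exists (inl y).
Qed.

Lemma no_isolated_cycle k : 1 < k -> no_isolated (cycle_graph k).
Proof.
move=> k1 i; exists (ordS i); rewrite /= /cycle_adj eqxx /= andbT -val_eqE /=.
have := ltn_ord i; rewrite leq_eqVlt => /orP[/eqP e|lt]; first by rewrite e modnn; lia.
by rewrite modn_small //; lia.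
Qed.

Section ConnectedNonbipartite.
Variables (T : sgraph) (z : T).
Hypotheses (Tcon : connected_graph T) (Tnonbip : ~ bipartite_graph T).

Lemma monochromatic_edge (c : T -> bool) : exists x y : T, adj x y /\ c x = c y.
Proof.
case: (boolP [exists x, exists y, adj x y && (c x == c y)]).
  by move=> /existsP[x /existsP[y /andP[xy /eqP cxy]]]; exists x, y.
move=> h; case: Tnonbip; exists c => x y xy; apply: contraNN h => cxy.
by apply/existsP; exists x; apply/existsP; exists y; rewrite xy.
Qed.

Lemma order_gt1 : 1 < #|T|.
Proof.
have [x [y [xy _]]] := monochromatic_edge (fun _ => true).
apply/card_gt1P; exists x, y; split=> //; apply/eqP => e.
by rewrite e adj_irrefl in xy.
Qed.

Lemma connected_no_isolated : no_isolated T.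
Proof.
move=> x.
have [y xy] : exists y, x != y.
  have /card_gt1P[a [b [_ _ ab]]] := order_gt1.
  by case: (eqVneq x a) ab => [<-|xa _]; [exists b | exists a].
have /connectP[[|u p] /= ] := Tcon x y; first by move=> _ e; rewrite e eqxx in xy.
by move=> /andP[xu _] _; exists u.
Qed.

Fixpoint reach (k : nat) (x : T) : bool :=
  if k is k'.+1 then [exists y, reach k' y && adj y x] else x == z.

Lemma reach_path k y p : reach k y -> path adj y p -> reach (size p + k) (last y p).
Proof.
elim: p k y => [|u p IH] k y ry; first by [].
rewrite [path _ _ _]/= => /andP[yu up].
rewrite -[size _]/(size p).+1 addSnnS; apply: IH => //=; apply/existsP; exists y.
by rewrite ry.
Qed.

Lemma reach_ex x : exists k, reach k x.
Proof.
have /connectP[p pp ->] := Tcon z x; exists (size p + 0).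
by apply: reach_path => //=.
Qed.

Let dist x := ex_minn (reach_ex x).

Lemma dist_reach x : reach (dist x) x.
Proof. by rewrite /dist; case: ex_minnP. Qed.
Lemma dist_min k x : reach k x -> dist x <= k.
Proof. by rewrite /dist; case: ex_minnP => d _ h /h. Qed.

Lemma parent_ex x : x != z -> exists2 y, adj x y & dist x = (dist y).+1.
Proof.
move=> xz; have := dist_reach x; case E : (dist x) => [|k] /=; first by rewrite (negPf xz).
move=> /existsP[y /andP[ry yx]]; exists y; first by rewrite adj_sym.
apply/eqP; rewrite eqn_leq -E; apply/andP; split.
  by apply: dist_min => /=; apply/existsP; exists y; rewrite dist_reach.
by rewrite E ltnS; apply: dist_min.
Qed.

(** Breadth-first search from z. The edges from a vertex to its parent are distinct
    and join vertices whose distances from z have different parities. Since T is not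
    bipartite, some edge joins two vertices with distances of equal parity, and this
    edge is not among the previous N - 1; it is attributed to z. *)
Lemma order_le_size : #|T| <= #|edges T|.
Proof.
have [x0 [y0 [xy0 c0]]] := monochromatic_edge (fun x => odd (dist x)).
pose par x := odflt x [pick y | adj x y && (dist x == (dist y).+1)].
have parP x : x != z -> adj x (par x) /\ dist x = (dist (par x)).+1.
  move=> /parent_ex[y xy d]; rewrite /par; case: pickP => [w /andP[? /eqP ?] //|/(_ y)].
  by rewrite xy d eqxx.
pose e x := if x == z then [set x0; y0] else [set x; par x].
have e_edge x : e x \in edges T.
  rewrite inE /e; case: eqVneq => [_|/parP[xp _]].
    by apply/existsP; exists x0; apply/existsP; exists y0; rewrite xy0 eqxx.
  by apply/existsP; exists x; apply/existsP; exists (par x); rewrite xp eqxx.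
have mono x : x != z -> [set x0; y0] = [set x; par x] -> False.
  move=> /parP[_ d] /setP E.
  have odd_c u : u \in [set x0; y0] -> odd (dist u) = odd (dist x0).
    by case/set2P => ->.
  have := odd_c x; rewrite E set21 => /(_ isT).
  have := odd_c (par x); rewrite E set22 => /(_ isT) <-.
  by rewrite d /=; case: odd.
have e_inj : injective e.
  move=> x x'; rewrite /e; case: (eqVneq x z) => [->|xz]; case: (eqVneq x' z) => [->|xz'] //.
  - by move=> /mono; case.
  - by move/esym => /mono; case.
  move=> /setP E; have /set2P[//|xp] : x \in [set x'; par x'] by rewrite -E set21.
  have /set2P[//|xp'] : x' \in [set x; par x] by rewrite E set21.
  have [_ d] := parP x xz; have [_ d'] := parP x' xz'.
  by move: d d'; rewrite -xp -xp'; lia.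
rewrite -(card_imset predT e_inj); apply: subset_leq_card.
apply/fintype.subsetP => _ /imsetP[x _ ->].
exact: e_edge.
Qed.

(** Equality as a target is a disjoint union of loops, on which a connected graph can
    only be mapped to a single one. *)
Lemma rhom_eq (V : finType) (v : V) : @rhom T z V eq_op v = 1.
Proof.
rewrite /rhom -(cards1 [ffun _ : T => v]); apply: eq_card => f; rewrite finset.in_set1 [LHS]inE.
apply/andP/eqP => [[/homsP h /eqP fz]|->]; last first.
  by split; [apply/homsP => x y _; rewrite !ffunE | rewrite ffunE].
apply/ffunP => x; rewrite ffunE -fz; have /connectP[p pp ->] := Tcon z x.
elim: p z {fz} pp => //= u p IH y /andP[yu up]; rewrite (IH _ up).
by rewrite (eqP (h _ _ yu)).
Qed.

Lemma rhom_gt0 (V : finType) (A : rel V) (v : V) : A v v -> 0 < rhom z A v.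
Proof.
move=> vv; apply/card_gt0P; exists [ffun => v]; rewrite inE; apply/andP; split.
  by apply/homsP => x y _; rewrite !ffunE.
by rewrite ffunE.
Qed.

End ConnectedNonbipartite.

Lemma rhom_aut (T : sgraph) (z : T) (V : finType) (A : rel V) (s : V -> V) :
  bijective s -> (forall u v, A (s u) (s v) = A u v) ->
  forall v, rhom z A (s v) = rhom z A v.
Proof.
move=> [t st ts] As v; rewrite /rhom.
pose push (s : V -> V) (f : {ffun T -> V}) := [ffun x => s (f x)].
have pushI : injective (push s).
  move=> f g /ffunP E; apply/ffunP => x; have := E x; rewrite !ffunE.
  exact: (can_inj st).
rewrite -[RHS](card_imset _ pushI); apply: eq_card => f; apply/idP/imsetP => [|[g + ->]].
  rewrite inE => /andP[/homsP h /eqP fz]; exists (push t f).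
    rewrite inE; apply/andP; split; last by rewrite ffunE fz st.
    by apply/homsP => x y /h; rewrite !ffunE -(As (t _)) !ts.
  by apply/ffunP => x; rewrite !ffunE ts.
rewrite [in X in X -> _]inE => /andP[/homsP h /eqP gz]; rewrite inE; apply/andP.
split; last by rewrite ffunE gz.
by apply/homsP => x y /h; rewrite !ffunE As.
Qed.

(** * A nearly bipartite vertex-transitive target *)

Section NearlyBipartite.
Variable m : nat.
(** The vertices of K_{m,m}, indexed so that the second component is the side.
    The relation [Kmm_adj] below has, in addition, a loop at every vertex. *)
Definition Kmm : finType := ('I_m * bool)%type.
Definition Kmm_adj : rel Kmm := fun u v => (u.2 != v.2) || (u.1 == v.1).

Lemma Kmm_sym : symmetric Kmm_adj.
Proof. by move=> u v; rewrite /Kmm_adj eq_sym [u.1 == _]eq_sym. Qed.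

Lemma deg_Kmm v : deg Kmm_adj v = m.+1.
Proof.
rewrite degE -(pair_big xpredT xpredT (fun i b => Kmm_adj v (i, b) : nat)) /=.
case: v => i b; under eq_bigr => j _ do rewrite big_bool /Kmm_adj.
transitivity (\sum_(j < m) (1 + (i == j))).
  by apply: eq_bigr => j _; case: b; case: (i == j).
rewrite big_split /= sum_nat_const card_ord muln1 (bigD1 i) //= eqxx big1 ?addn0 ?addn1 //.
by move=> j; rewrite eq_sym => /negPf ->.
Qed.

Lemma rhom_Kmm (T : sgraph) (z : T) (u v : Kmm) :
  rhom z Kmm_adj u = rhom z Kmm_adj v.
Proof.
pose s (w : Kmm) : Kmm := (tperm u.1 v.1 w.1, w.2 (+) (u.2 (+) v.2)).
have sK : involutive s by case=> i b; rewrite /s /= tpermK -addbA addbb addbF.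
have <- : s u = v by case: v @s sK => j c; case: u => i b s sK; rewrite /s /= tpermL addKb.
apply/esym/rhom_aut; first exact: inv_bij.
move=> [i b] [j c]; rewrite /Kmm_adj /= (inj_eq perm_inj); congr (~~ _ || _).
by case: b; case: c; case: (u.2); case: (v.2).
Qed.

(** The sides would give a proper 2-colouring of T, so some edge is mapped inside a
    side, hence to a loop, and its two ends are identified. *)
Lemma card_homs_Kmm (T : sgraph) : ~ bipartite_graph T ->
  #|homs T Kmm_adj| <= #|T| ^ 2 * (m * 2) ^ #|T|.-1.
Proof.
move=> Tnonbip.
have cl : #|Kmm| = m * 2 by rewrite card_prod card_ord card_bool.
pose S (p : T * T) : {set {ffun T -> Kmm}} :=
  [set f : {ffun T -> Kmm} | f p.1 == f p.2].
apply: (@leq_trans (\sum_(p : T * T | p.1 != p.2) #|S p|)).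
  rewrite -sum1_card big_mkcond /=.
  under [leqRHS]eq_bigr => p _ do rewrite -sum1_card big_mkcond /=.
  rewrite exchange_big /=; apply: leq_sum => f _; case: ifP => // /homsP h.
  have [x [y [xy c]]] := monochromatic_edge Tnonbip (fun x => (f x).2).
  rewrite (bigD1 (x, y)) /=; last by apply: contraTneq xy => ->; rewrite adj_irrefl.
  rewrite inE /=; have := h _ _ xy; rewrite /Kmm_adj c eqxx /= => /eqP c1.
  by rewrite -pair_eqE /pair_eq /= c c1 !eqxx.
have cS p : p.1 != p.2 -> #|S p| = (m * 2) ^ #|T|.-1.
  by move=> xy; rewrite -cl; exact: card_collision.
rewrite (eq_bigr _ cS) sum_nat_const leq_mul2r; apply/orP; right.
by rewrite -mulnn -card_prod max_card.
Qed.
End NearlyBipartite.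

(** * Averages over a finite set *)

Section LogConvex.
Local Open Scope ring_scope.
Variable R : realFieldType.

(** The ratios s (k+1) / s k are nondecreasing, so s 1 / s 0 is the smallest of them.
    They are compared in product form since terms may vanish. *)
Lemma logconvex_pow (s : nat -> R) :
  (forall k, 0 <= s k) -> (forall k, s k.+1 ^+ 2 <= s k * s k.+2) ->
  forall k, s 1%N ^+ k.+1 <= s 0%N ^+ k * s k.+1.
Proof.
move=> s0 lc.
have ratio k : s 1%N * s k <= s 0%N * s k.+1.
  elim: k => [|k IH]; first by rewrite mulrC.
  have := s0 k.+1; rewrite le_eqVlt => /orP[/eqP <-|sk]; first by rewrite mulr0 mulr_ge0.
  rewrite -(ler_pM2r sk) -mulrA -expr2.
  apply: (@le_trans _ _ (s 1%N * (s k * s k.+2))); first by rewrite ler_wpM2l.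
  by rewrite mulrA [leRHS]mulrAC ler_wpM2r.
elim=> [|k IH]; first by rewrite expr0 mul1r expr1.
rewrite exprS; apply: (@le_trans _ _ (s 1%N * (s 0%N ^+ k * s k.+1))); first by rewrite ler_wpM2l.
by rewrite mulrCA exprSr -[leRHS]mulrA ler_wpM2l // exprn_ge0.
Qed.
End LogConvex.

Section Average.
Local Open Scope ring_scope.
Variables (R : realFieldType) (V : finType).

Definition avg (g : V -> R) : R := #|V|%:R^-1 * \sum_x g x.

Lemma eq_avg f g : f =1 g -> avg f = avg g.
Proof. by move=> fg; rewrite /avg (eq_bigr _ (fun x _ => fg x)). Qed.

Lemma avg_ge0 g : (forall x, 0 <= g x) -> 0 <= avg g.
Proof. by move=> g0; rewrite mulr_ge0 ?invr_ge0 ?sumr_ge0. Qed.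

Lemma ler_avg f g : (forall x, f x <= g x) -> avg f <= avg g.
Proof. by move=> fg; rewrite ler_wpM2l ?invr_ge0 // ler_sum. Qed.

Lemma avgD f g : avg (fun x => f x + g x) = avg f + avg g.
Proof. by rewrite /avg big_split mulrDr. Qed.

Lemma avgZ c g : avg (fun x => c * g x) = c * avg g.
Proof. by rewrite /avg -big_distrr /= mulrCA. Qed.

Lemma avgZr c g : avg (fun x => g x * c) = avg g * c.
Proof. by rewrite mulrC -avgZ; apply: eq_avg => x; rewrite mulrC. Qed.

Lemma avgN g : avg (fun x => - g x) = - avg g.
Proof. by rewrite /avg sumrN mulrN. Qed.

Lemma avgB f g : avg (fun x => f x - g x) = avg f - avg g.
Proof. by rewrite avgD avgN. Qed.

Lemma avg_norm g : `|avg g| <= avg (fun x => `|g x|).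
Proof.
by rewrite normrM ger0_norm ?invr_ge0 // ler_wpM2l ?invr_ge0 // ler_norm_sum.
Qed.

Lemma avg_CS f g :
  avg (fun x => f x * g x) ^+ 2 <= avg (fun x => f x ^+ 2) * avg (fun x => g x ^+ 2).
Proof.
rewrite /avg exprMn [leRHS]mulrACA -[_^-1 * _^-1]expr2 ler_wpM2l ?exprn_ge0 ?invr_ge0 //.
set a := \sum_x f x ^+ 2; set b := \sum_x g x ^+ 2; set c := \sum_x _.
have a0 : 0 <= a by apply: sumr_ge0 => x _; exact: sqr_ge0.
(* The quadratic polynomial is a sum of squares, so its discriminant is at most 0. *)
have H t : 0 <= a * t ^+ 2 - 2 * c * t + b.
  have -> : a * t ^+ 2 - 2 * c * t + b = \sum_x (f x * t - g x) ^+ 2.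
    rewrite /a /b /c mulr_sumr !mulr_suml -sumrB -big_split /=.
    by apply: eq_bigr => x _; ring.
  by apply: sumr_ge0 => x _; exact: sqr_ge0.
move: a0; rewrite le_eqVlt => /orP[/eqP a0|a0]; last first.
  have := H (c / a); rewrite -(pmulr_rge0 _ a0).
  have -> : a * (a * (c / a) ^+ 2 - 2 * c * (c / a) + b) = a * b - c ^+ 2.
    by field; rewrite gt_eqF.
  by rewrite subr_ge0.
rewrite -a0 mul0r; have [c0|cn] := eqVneq c 0; first by rewrite c0 expr0n.
have := H ((b + 1) / (2 * c)); rewrite -a0.
have -> : 0 * ((b + 1) / (2 * c)) ^+ 2 - 2 * c * ((b + 1) / (2 * c)) + b = -1.
  by field; rewrite cn.
by lra.
Qed.

Hypothesis V0 : (0 < #|V|)%N.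

Lemma avg_const c : avg (fun _ => c) = c.
Proof.
rewrite /avg sumr_const -[c *+ _]mulr_natl mulrA mulVf ?mul1r //.
by rewrite pnatr_eq0 -lt0n.
Qed.

Lemma avg_sqr f : avg f ^+ 2 <= avg (fun x => f x ^+ 2).
Proof.
have := avg_CS f (fun => 1).
rewrite (eq_avg (fun x => mulr1 (f x))) (@eq_avg (fun => 1 ^+ 2) (fun => 1)) => [|x].
  by rewrite avg_const mulr1.
by rewrite expr1n.
Qed.

Lemma avg_le1 f : (forall x, f x <= 1) -> avg f <= 1.
Proof. by move=> f1; rewrite -[leRHS]avg_const; apply: ler_avg. Qed.

Lemma avg_norm_le1 f : (forall x, `|f x| <= 1) -> `|avg f| <= 1.
Proof. by move=> f1; apply: le_trans (avg_norm f) _; apply: avg_le1. Qed.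

End Average.

Section Exchange.
Local Open Scope ring_scope.
Lemma avg_exchange (R : realFieldType) (V W : finType) (g : V -> W -> R) :
  avg (fun x => avg (g x)) = avg (fun y => avg (g^~ y)).
Proof.
rewrite /avg -!mulr_sumr mulrCA; congr (_ * (_ * _)).
by rewrite exchange_big.
Qed.
End Exchange.

(** * The averaging operator of a relation *)

Section Operator.
Local Open Scope ring_scope.
Variables (R : realFieldType) (V : finType) (A : rel V).
Hypotheses (Asym : symmetric A) (V0 : (0 < #|V|)%N).
Local Notation n := (#|V|%:R : R).

(** The adjacency operator, divided by the number of vertices. *)
Definition aop (v : V -> R) (x : V) : R := avg (fun y => (A x y)%:R * v y).
Definition ndeg : V -> R := aop (fun=> 1).
(** The kernel of the (k+1)-st iterate of [aop] ([iter_aop]). The shift of the index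
    leaves out the identity, whose kernel is not bounded independently of V. *)
Definition nwalk k (x y : V) : R := (walks A k.+1 x y)%:R / n ^+ k.

Let n0 : n != 0. Proof. by rewrite pnatr_eq0 -lt0n. Qed.

Lemma ndegE x : ndeg x = (deg A x)%:R / n.
Proof.
rewrite /ndeg /aop /avg degE natr_sum mulrC; congr (_ / _).
by apply: eq_bigr => y _; rewrite mulr1.
Qed.

Lemma nwalk0 x y : nwalk 0 x y = (A x y)%:R.
Proof. by rewrite /nwalk walks1 expr0 divr1. Qed.

Lemma nwalkS k x y : nwalk k.+1 x y = avg (fun u => (A x u)%:R * nwalk k u y).
Proof.
rewrite /nwalk -[walks _ k.+2 _ _]/(\sum_u A x u * walks A k.+1 u y)%N natr_sum.
rewrite /avg mulrC exprS invfM -mulrA; congr (_ * _); rewrite mulr_sumr.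
by apply: eq_bigr => u _; rewrite natrM; ring.
Qed.

Lemma iter_aop k v x : iter k.+1 aop v x = avg (fun y => nwalk k x y * v y).
Proof.
elim: k x => [|k IH] x.
  by apply: eq_avg => y; rewrite nwalk0.
rewrite iterS /aop; under eq_avg => u do rewrite IH -avgZ.
rewrite avg_exchange; apply: eq_avg => y; rewrite nwalkS -avgZr.
by apply: eq_avg => u; rewrite mulrA.
Qed.

Lemma nwalk_ge0 k x y : 0 <= nwalk k x y.
Proof. by rewrite divr_ge0 ?exprn_ge0. Qed.

Lemma aop_norm v : (forall x, `|v x| <= 1) -> forall x, `|aop v x| <= 1.
Proof.
move=> v1 x; apply: avg_norm_le1 => // y; rewrite normrM.
by case: (A x y); rewrite ?normr0 ?normr1 ?mul0r ?mul1r.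
Qed.

Lemma iter_aop_norm k v : (forall x, `|v x| <= 1) -> forall x, `|iter k aop v x| <= 1.
Proof. by move=> v1; elim: k => //= k IH; apply: aop_norm. Qed.

Lemma nwalk_le1 k x y : nwalk k x y <= 1.
Proof.
elim: k x => [|k IH] x; first by rewrite nwalk0 lern1; case: (A x y).
rewrite nwalkS; apply: avg_le1 => // u.
by case: (A x u); rewrite ?mul0r ?mul1r.
Qed.

Lemma aopB v w x : aop (fun y => v y - w y) x = aop v x - aop w x.
Proof. by rewrite -avgB; apply: eq_avg => y; rewrite mulrBr. Qed.

Lemma ndeg_ge0 x : 0 <= ndeg x.
Proof. by apply: avg_ge0 => y; rewrite mulr1. Qed.

Lemma ndeg_norm x : `|ndeg x| <= 1.
Proof. by apply: aop_norm => ?; rewrite normr1. Qed.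

Lemma ndeg_le1 x : ndeg x <= 1.
Proof. exact: le_trans (ler_norm _) (ndeg_norm x). Qed.

Lemma aop_adj u v : avg (fun x => u x * aop v x) = avg (fun x => aop u x * v x).
Proof.
under eq_avg => x do rewrite -avgZ.
rewrite avg_exchange; apply: eq_avg => y; rewrite -avgZr.
by apply: eq_avg => x; rewrite Asym; ring.
Qed.

(** As [aop] is self-adjoint, the squared norm of the (k+1)-st iterate is the scalar
    product of the k-th and the (k+2)-nd. *)
Lemma aop_logconvex v k :
  avg (fun x => iter k.+1 aop v x ^+ 2) ^+ 2 <=
  avg (fun x => iter k aop v x ^+ 2) * avg (fun x => iter k.+2 aop v x ^+ 2).
Proof.
suff -> : avg (fun x => iter k.+1 aop v x ^+ 2) =
  avg (fun x => iter k aop v x * iter k.+2 aop v x) by exact: avg_CS.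
by rewrite [RHS](aop_adj _ (iter k.+1 aop v)); apply: eq_avg => x; rewrite expr2.
Qed.

Lemma aop_moment v k : (forall x, `|v x| <= 1) ->
  avg (fun x => aop v x ^+ 2) ^+ k.+1 <= avg (fun x => iter k.+1 aop v x ^+ 2).
Proof.
move=> v1; pose s k := avg (fun x => iter k aop v x ^+ 2).
have s0 j : 0 <= s j by apply: avg_ge0 => x; exact: sqr_ge0.
have := logconvex_pow s0 (aop_logconvex v) k.
rewrite -[s 1%N]/(avg (fun x => aop v x ^+ 2)) => h; apply: le_trans h _.
rewrite -[leRHS]mul1r ler_wpM2r // exprn_ile1 //; apply: avg_le1 => // x.
by rewrite -real_normK ?num_real // exprn_ile1.
Qed.

(** The density of the cycle of length 2(k+1), see [tdens_cycle]. *)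
Definition wsq k : R := avg (fun x => avg (fun y => nwalk k x y ^+ 2)).

(** The moment inequality for the constant function 1, whose image is the degree. *)
Lemma ndeg_sqr_wsq k : avg (fun x => ndeg x ^+ 2) ^+ k.+1 <= wsq k.
Proof.
apply: le_trans (aop_moment k _) _ => [x|]; first by rewrite normr1.
apply: ler_avg => x; rewrite iter_aop (eq_avg (fun y => mulr1 (nwalk k x y))).
exact: avg_sqr.
Qed.

Lemma avg_ndeg_wsq k : avg ndeg ^+ (2 * k.+1) <= wsq k.
Proof.
apply: le_trans (ndeg_sqr_wsq k); rewrite exprM lerXn2r ?nnegrE ?sqr_ge0 //.
  by apply: avg_ge0 => x; exact: sqr_ge0.
exact: avg_sqr.
Qed.

Definition awalk k : R := avg (iter k aop (fun=> 1)).

Lemma awalk0 : awalk 0 = 1. Proof. exact: avg_const. Qed.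

(** Moving one application of the operator to the other side turns it into the degree
    function. *)
Lemma awalkS p k : `|awalk k.+1 - p * awalk k| <= avg (fun x => `|ndeg x - p|).
Proof.
have -> : awalk k.+1 = avg (fun x => ndeg x * iter k aop (fun=> 1) x).
  by rewrite -aop_adj; apply: eq_avg => x; rewrite mul1r.
rewrite -avgZ -avgB; apply: le_trans (avg_norm _) _; apply: ler_avg => x.
rewrite -mulrBl normrM -[leRHS]mulr1 ler_wpM2l //.
by apply: iter_aop_norm => ?; rewrite normr1.
Qed.

Lemma avg_dev_sqr p k :
  avg (fun x => avg (fun y => (nwalk k x y - p) ^+ 2)) =
  wsq k - 2 * p * awalk k.+1 + p ^+ 2.
Proof.
have E x : avg (fun y => (nwalk k x y - p) ^+ 2) =
   avg (fun y => nwalk k x y ^+ 2) - 2 * p * iter k.+1 aop (fun=> 1) x + p ^+ 2.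
  rewrite iter_aop -avgZ -avgB -[X in _ = _ + X](@avg_const _ V) // -avgD.
  by apply: eq_avg => y; ring.
by rewrite (eq_avg E) avgD avgB (avgZ (2 * p)) avg_const.
Qed.

(** A function of mean zero does not see a constant subtracted from a kernel. Hence
    the (k+1)-st iterate is controlled by the distance of its kernel from p, and
    log-convexity passes from the iterate to the operator itself. This takes the place
    of a bound on the second eigenvalue. *)
Lemma aop_meanzero p k u v : (forall x, `|u x| <= 1) -> (forall x, `|v x| <= 1) ->
  avg v = 0 ->
  avg (fun x => u x * aop v x) ^+ (2 * k.+1) <=
  avg (fun x => avg (fun y => (nwalk k x y - p) ^+ 2)).
Proof.
move=> u1 v1 v0; rewrite exprM.
have le1 (w : V -> R) : (forall x, `|w x| <= 1) -> avg (fun x => w x ^+ 2) <= 1.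
  move=> w1; apply: avg_le1 => // x.
  by rewrite -real_normK ?num_real // exprn_ile1.
have sq0 (w : V -> R) : 0 <= avg (fun x => w x ^+ 2).
  by apply: avg_ge0 => x; exact: sqr_ge0.
apply: (@le_trans _ _ (avg (fun x => aop v x ^+ 2) ^+ k.+1)).
  rewrite lerXn2r ?nnegrE ?sqr_ge0 //; apply: le_trans (avg_CS _ _) _.
  by rewrite -[leRHS]mul1r ler_wpM2r // le1.
apply: le_trans (aop_moment k v1) _; apply: ler_avg => x.
have -> : iter k.+1 aop v x = avg (fun y => (nwalk k x y - p) * v y).
  rewrite iter_aop -[LHS]subr0 -(mulr0 p) -v0 -avgZ -avgB.
  by apply: eq_avg => y; rewrite mulrBl.
apply: le_trans (avg_CS _ _) _; rewrite -[leRHS]mulr1 ler_wpM2l //; exact: le1.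
Qed.

(** Split v into its mean, which is tested against the degrees, and a function of
    mean zero. *)
Lemma cut_bound p q k u v (e : R) :
  (forall x, 0 <= u x <= 1) -> (forall x, 0 <= v x <= 1) -> 0 <= e ->
  avg (fun x => avg (fun y => (nwalk k x y - q) ^+ 2)) <= e ^+ (2 * k.+1) ->
  `|avg (fun x => u x * aop v x) - p * (avg u * avg v)| <=
  e + avg (fun x => `|ndeg x - p|).
Proof.
move=> u1 v1 e0 he; pose v' x := v x - avg v.
have norm1 (w : V -> R) : (forall x, 0 <= w x <= 1) -> forall x, `|w x| <= 1.
  by move=> w1 x; have /andP[? ?] := w1 x; rewrite ger0_norm.
have av : 0 <= avg v <= 1.
  by apply/andP; split; [apply: avg_ge0|apply: avg_le1] => // x; have /andP[] := v1 x.
have v'1 x : `|v' x| <= 1.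
  by rewrite ler_norml; have := v1 x; move: av => /andP[? ?] /andP[? ?]; rewrite /v'; lra.
have v'0 : avg v' = 0 by rewrite avgB avg_const // subrr.
have h1 : `|avg (fun x => u x * aop v' x)| <= e.
  rewrite -(@ler_pXn2r _ (2 * k.+1)) ?nnegrE //.
  rewrite -normrX ger0_norm; last by rewrite exprM exprn_ge0 ?sqr_ge0.
  by apply: le_trans (aop_meanzero q k (norm1 _ u1) v'1 v'0) he.
have E x : aop v' x = aop v x - avg v * ndeg x.
  by rewrite aopB; congr (_ - _); rewrite /ndeg -avgZ; apply: eq_avg => y; ring.
have -> : avg (fun x => u x * aop v x) - p * (avg u * avg v) =
   avg (fun x => u x * aop v' x) + avg v * avg (fun x => u x * (ndeg x - p)).
  have -> : avg (fun x => u x * aop v' x) =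
     avg (fun x => u x * aop v x) - avg v * avg (fun x => u x * ndeg x).
    by rewrite -avgZ -avgB; apply: eq_avg => x; rewrite E; ring.
  have -> : avg (fun x => u x * (ndeg x - p)) = avg (fun x => u x * ndeg x) - p * avg u.
    by rewrite -avgZ -avgB; apply: eq_avg => x; ring.
  by ring.
apply: le_trans (ler_normD _ _) _; apply: lerD => //.
rewrite normrM -[leRHS]mul1r; apply: ler_pM => //.
  by move: av => /andP[? ?]; rewrite ger0_norm.
apply: le_trans (avg_norm _) _; apply: ler_avg => x.
by rewrite normrM -[leRHS]mul1r ler_wpM2r // norm1.
Qed.

End Operator.

(** * The counting lemma *)

Section Counting.
Local Open Scope ring_scope.
Variables (R : realFieldType) (V : finType) (A : rel V).
Hypotheses (Asym : symmetric A) (V0 : (0 < #|V|)%N).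

Definition tdens (H : sgraph) : R := #|homs H A|%:R / #|V|%:R ^+ #|H|.

Definition edgeprod (H : finType) (s : seq (H * H)) (f : {ffun H -> V}) : R :=
  \prod_(e <- s) (A (f e.1) (f e.2))%:R.

Lemma avg_upd (H : finType) (x : H) (g : {ffun H -> V} -> R) :
  avg (fun f => avg (fun a => g (upd f x a))) = avg g.
Proof.
rewrite /avg -!mulr_sumr (big_upd _ x g); congr (_ * _).
under eq_bigr => f _ do rewrite sumr_const.
rewrite sumrMnl -[X in _ * X = _]mulr_natl mulrA mulVf ?mul1r //.
by rewrite pnatr_eq0 -lt0n.
Qed.

Lemma avg_upd2 (H : finType) (x y : H) (g : {ffun H -> V} -> R) :
  avg (fun f => avg (fun a => avg (fun b => g (upd (upd f x a) y b)))) = avg g.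
Proof. by rewrite (avg_upd x (fun f => avg (fun b => g (upd f y b)))) avg_upd. Qed.

Definition simple_arcs (H : finType) (s : seq (H * H)) :=
  uniq s /\ {in s, forall e, e.1 != e.2 /\ (e.2, e.1) \notin s}.

Lemma prodr01 (I : Type) (s : seq I) (P : pred I) (b : I -> bool) :
  0 <= (\prod_(i <- s | P i) (b i)%:R : R) <= 1.
Proof.
elim/big_rec: _ => [|i x _ /andP[x0 x1]]; first by rewrite ler01 lexx.
by case: (b i); rewrite ?mul1r ?mul0r ?x0 ?x1 ?lexx ?ler01.
Qed.

(** Remove the edges one at a time. When all images except those of the ends x and y
    of an edge are fixed, the factors of the other edges split into a function of the
    image of x and one of the image of y, because no other edge joins x to y; the
    cut-norm hypothesis then allows to replace the factor of the edge by p. *)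
Lemma avg_edgeprod (H : finType) (s : seq (H * H)) (p e : R) :
  simple_arcs s -> 0 <= p <= 1 -> 0 <= e ->
  (forall u v : V -> R, (forall x, 0 <= u x <= 1) -> (forall x, 0 <= v x <= 1) ->
     `|avg (fun x => u x * aop A v x) - p * (avg u * avg v)| <= e) ->
  `|avg (edgeprod s) - p ^+ size s| <= (size s)%:R * e.
Proof.
move=> + /andP[p0 p1] e0 cut; elim: s => [|[x y] s IH] [us hs].
  have -> : avg (edgeprod (H := H) [::]) = 1.
    rewrite -(@avg_const R {ffun H -> V} _ 1) ?card_ffun ?expn_gt0 ?V0 //.
    by apply: eq_avg => f; rewrite /edgeprod big_nil.
  by rewrite expr0 subrr normr0 mul0r.
have /andP[xys us'] := us.
have [/= xy yxs] := hs (x, y) (mem_head _ _).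
have {}IH : `|avg (edgeprod s) - p ^+ size s| <= (size s)%:R * e.
  apply: IH; split=> // f fs; have [|f12 f21] := hs f; first by rewrite inE fs orbT.
  by split=> //; move: f21; rewrite inE negb_or => /andP[].
(* U collects the edges that avoid y, W those at y; neither contains the edge xy. *)
pose U (f : {ffun H -> V}) a : R :=
  \prod_(e <- s | ~~ ((e.1 == y) || (e.2 == y))) (A (upd f x a e.1) (upd f x a e.2))%:R.
pose W (f : {ffun H -> V}) b : R :=
  \prod_(e <- s | (e.1 == y) || (e.2 == y)) (A (upd f y b e.1) (upd f y b e.2))%:R.
have UW f a b : edgeprod s (upd (upd f x a) y b) = U f a * W f b.
  rewrite /edgeprod (bigID (fun e => (e.1 == y) || (e.2 == y))) /= mulrC; congr (_ * _).
    apply: eq_bigr => -[c d] /=; rewrite negb_or => /andP[cy dy].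
    by rewrite /upd !ffunE (negPf cy) (negPf dy).
  rewrite big_seq_cond [RHS]big_seq_cond; apply: eq_bigr => -[c d] /= /andP[cds cdy].
  suff [cx dx] : c != x /\ d != x by rewrite /upd !ffunE (negPf cx) (negPf dx).
  have [] := hs (c, d); first by rewrite inE cds orbT.
  move=> /= cd _; move: cdy; case: (eqVneq c y) => [cy _|cy /eqP dy].
    split; first by rewrite cy eq_sym.
    by apply: contraNneq yxs => <-; rewrite -cy inE cds orbT.
  split; last by rewrite dy eq_sym.
  by apply: contraNneq xys => <-; rewrite -dy.
have E1 : avg (edgeprod ((x, y) :: s)) =
    avg (fun f => avg (fun a => U f a * aop A (W f) a)).
  rewrite -(avg_upd2 x y); apply: eq_avg => f; apply: eq_avg => a.
  rewrite /aop -avgZ; apply: eq_avg => b; rewrite mulrCA -UW /edgeprod big_cons /=.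
  by congr (_%:R * _); rewrite /upd !ffunE eqxx (negPf xy) eqxx.
have E2 : avg (edgeprod s) = avg (fun f => avg (U f) * avg (W f)).
  rewrite -(avg_upd2 x y); apply: eq_avg => f; rewrite -avgZr; apply: eq_avg => a.
  by rewrite -avgZ; apply: eq_avg => b; exact: UW.
have step : `|avg (edgeprod ((x, y) :: s)) - p * avg (edgeprod s)| <= e.
  rewrite E1 E2 -avgZ -avgB; apply: le_trans (avg_norm _) _.
  rewrite -[leRHS](@avg_const R {ffun H -> V}) ?card_ffun ?expn_gt0 ?V0 //.
  by apply: ler_avg => f; apply: cut => z; exact: prodr01.
rewrite [size _]/= exprS.
have -> : avg (edgeprod ((x, y) :: s)) - p * p ^+ size s =
  (avg (edgeprod ((x, y) :: s)) - p * avg (edgeprod s)) +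
  p * (avg (edgeprod s) - p ^+ size s) by ring.
apply: le_trans (ler_normD _ _) _; rewrite -nat1r mulrDl mul1r lerD //.
rewrite normrM (ger0_norm p0); apply: le_trans _ IH.
by rewrite -[leRHS]mul1r ler_wpM2r.
Qed.

Lemma tdens_avg (H : sgraph) : tdens H = avg (fun f => (f \in homs H A)%:R : R).
Proof.
rewrite /tdens /avg card_ffun natrX mulrC; congr (_ * _).
by rewrite -sum1_card natr_sum big_mkcond /=; apply: eq_bigr => f _; case: (f \in _).
Qed.

Lemma homs_edgeprod (H : sgraph) (f : {ffun H -> V}) :
  (f \in homs H A)%:R = edgeprod (enum (fwd H)) f.
Proof.
rewrite /edgeprod; case: (boolP (f \in homs H A)) => [/homsP h|].
  rewrite big1_seq // => -[x y]; rewrite mem_enum inE /= => /andP[xy _].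
  by rewrite h.
move=> h; apply/esym/eqP; apply: contraNT h; rewrite prodf_seq_neq0 => /allP h.
have hfwd x y : adj x y -> (enum_rank x < enum_rank y)%N -> A (f x) (f y).
  move=> xy lt; have := h (x, y); rewrite mem_enum inE /= xy lt => /(_ isT).
  by case: (A _ _) => //; rewrite eqxx.
apply/homsP => x y xy; have [|gt|/val_inj/enum_rank_inj e] := ltngtP (enum_rank x) (enum_rank y).
- exact: hfwd.
- by rewrite Asym; apply: hfwd => //; rewrite adj_sym.
- by rewrite e adj_irrefl in xy.
Qed.

Lemma simple_fwd (H : sgraph) : simple_arcs (enum (fwd H)).
Proof.
split; first exact: enum_uniq.
move=> [x y]; rewrite !mem_enum !inE /= => /andP[xy lt]; split.
  by apply: contraTneq xy => ->; rewrite adj_irrefl.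
by rewrite negb_and -leqNgt (ltnW lt) orbT.
Qed.

Lemma counting_lemma (H : sgraph) (p e : R) : 0 <= p <= 1 -> 0 <= e ->
  (forall u v : V -> R, (forall x, 0 <= u x <= 1) -> (forall x, 0 <= v x <= 1) ->
     `|avg (fun x => u x * aop A v x) - p * (avg u * avg v)| <= e) ->
  `|tdens H - p ^+ #|edges H| | <= #|edges H|%:R * e.
Proof.
move=> p01 e0 cut; rewrite tdens_avg (eq_avg (@homs_edgeprod H)) -card_fwd cardE.
exact: avg_edgeprod (simple_fwd H) p01 e0 cut.
Qed.
End Counting.

(** * Quasirandomness from one even cycle *)

Section Limits.
Local Open Scope classical_set_scope.
Local Open Scope ring_scope.
Variable R : realType.
Implicit Types (u v w : nat -> R) (l : R).

(** Superadditivity of the power function on nonnegative numbers. *)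
Lemma ler_exp_diff (k : nat) (a b : R) : 0 <= a -> 0 <= b ->
  `|a - b| ^+ k.+1 <= `|a ^+ k.+1 - b ^+ k.+1|.
Proof.
have superadd (x y : R) : 0 <= x -> 0 <= y -> x ^+ k.+1 + y ^+ k.+1 <= (x + y) ^+ k.+1.
  move=> x0 y0; elim: k => [|j IH]; first by rewrite !expr1.
  rewrite ![_ ^+ j.+2]exprS; apply: (@le_trans _ _ ((x + y) * (x ^+ j.+1 + y ^+ j.+1))).
    rewrite mulrDl !mulrDr lerD // ?lerDl ?lerDr ?mulr_ge0 ?exprn_ge0 //.
  by rewrite ler_wpM2l // addr_ge0.
wlog ab : a b / b <= a.
  move=> H a0 b0; have [ba|/ltW ab] := leP b a; first exact: H.
  by rewrite distrC [leRHS]distrC; apply: H.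
move=> a0 b0; rewrite ger0_norm ?subr_ge0 // ger0_norm; last first.
  by rewrite subr_ge0 lerXn2r.
rewrite lerBrDl; apply: le_trans (superadd _ _ b0 _) _; first by rewrite subr_ge0.
by rewrite subrKC.
Qed.

(** The case l = 0 is included, where the root is not a Lipschitz function. *)
Lemma cvg_root k u l : 0 <= l -> (forall n, 0 <= u n) ->
  (u n ^+ k.+1 @[n --> \oo] --> l ^+ k.+1) -> u @ \oo --> l.
Proof.
move=> l0 u0 /cvgrPdist_le h; apply/cvgrPdist_le => e e0.
have := h (e ^+ k.+1) (exprn_gt0 _ e0); apply: filterS => n hn.
rewrite -(@ler_pXn2r _ k.+1) ?nnegrE ?(ltW e0) //.
by apply: le_trans hn; apply: ler_exp_diff.
Qed.

Lemma cvg_squeeze0 u v : (forall n, `|u n| <= v n) -> v @ \oo --> 0 -> u @ \oo --> 0.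
Proof.
move=> uv /cvgrPdist_le h; apply/cvgrPdist_le => e /h; apply: filterS => n.
rewrite !sub0r !normrN; apply: le_trans; apply: le_trans (uv n) _; exact: ler_norm.
Qed.

Lemma cvg_squeeze u v w l : (forall n, u n <= v n <= w n) ->
  u @ \oo --> l -> w @ \oo --> l -> v @ \oo --> l.
Proof. by move=> uvw; apply: squeeze_cvgr; near=> n; apply: uvw. Unshelve. all: by end_near. Qed.

Lemma cvg_diff0 u v l : u @ \oo --> l -> (fun n => v n - u n) @ \oo --> 0 -> v @ \oo --> l.
Proof.
move=> ul vu; have -> : v = (fun n => (v n - u n) + u n) by apply: funext => n; rewrite subrK.
by rewrite -[l]add0r; apply: cvgD.
Qed.

Lemma cvgXn u l k : u @ \oo --> l -> (fun n => u n ^+ k) @ \oo --> l ^+ k.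
Proof.
move=> ul; elim: k => [|k IH]; first exact: cvg_cst.
by rewrite exprS; under eq_fun do rewrite exprS; apply: cvgM.
Qed.

(** The empty graph at n = 0 is left out by a shift of the index, so that densities
    are averages over nonempty sets. *)
Lemma hom_asympE (G : nat -> sgraph) (p : R) (H : sgraph) : (forall n, #|G n| = n) ->
  hom_asymp G p H <->
  (fun n => tdens R (@adj (G n.+1)) H) @ \oo --> p ^+ #|edges H|.
Proof.
move=> Gn; have homE n : (Defs.hom H (G n))%:R = tdens R (@adj (G n)) H * n%:R ^+ #|H|.
  rewrite /tdens Gn; case: n => [|n]; last by rewrite divfK // expf_neq0 ?pnatr_eq0.
  case: (posnP #|H|) => [H0|Hp]; first by rewrite H0 !expr0 mulr1 divr1.
  rewrite expr0n (gtn_eqF Hp) mulr0; apply/eqP; rewrite pnatr_eq0 -leqn0 leqNgt.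
  apply/negP => /card_gt0P[f _]; have /card_gt0P[x _] := Hp.
  by have := enum_rank (f x); rewrite Gn => -[].
split=> [[err err0 E]|h].
  have : (fun n => p ^+ #|edges H| + err n.+1) @ \oo --> p ^+ #|edges H|.
    by rewrite -[X in _ --> X]addr0; apply: cvgD; [exact: cvg_cst|rewrite (cvg_shiftS err)].
  apply: cvg_trans; apply: near_eq_cvg; near=> n.
  have := E n.+1; rewrite homE => /mulIf E'; apply/esym/E'.
  by rewrite expf_neq0 ?pnatr_eq0.
exists (fun n => tdens R (@adj (G n)) H - p ^+ #|edges H|).
  rewrite -(subrr (p ^+ #|edges H|)); apply: cvgB; last exact: cvg_cst.
  by rewrite -(cvg_shiftS (fun n => tdens R (@adj (G n)) H)).
by move=> n; rewrite homE subrKC.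
Unshelve. all: by end_near.
Qed.

(** Since (E[d])^2 <= E[d^2] <= t(C)^(1/(k+1)), both bounds force E[d^2] to p^2, so
    d tends to p in the mean. Then the walk densities tend to powers of p, and the
    walk kernel tends in L2 to a constant. By [cut_bound] the graph is close to p in
    the cut norm, which is what [counting_lemma] needs. *)
Lemma quasirandom_criterion (G : nat -> sgraph) (p : R) k :
  (forall n, 0 < #|G n|)%N -> 0 <= p <= 1 ->
  (fun n => avg (ndeg R (@adj (G n)))) @ \oo --> p ->
  (fun n => wsq R (@adj (G n)) k) @ \oo --> p ^+ (2 * k.+1) ->
  forall H, (fun n => tdens R (@adj (G n)) H) @ \oo --> p ^+ #|edges H|.
Proof.
move=> G0 /[dup] p01 /andP[p0 p1] hd hw H.
pose d n := ndeg R (@adj (G n)).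
have e2 : (fun n => avg (fun x => d n x ^+ 2)) @ \oo --> p ^+ 2.
  apply: (@cvg_root k); [exact: sqr_ge0| |].
    by move=> n; apply: avg_ge0 => x; exact: sqr_ge0.
  rewrite -exprM; apply: (cvg_squeeze _ (cvgXn (k := (2 * k.+1)%N) hd) hw) => n; apply/andP; split.
    rewrite exprM lerXn2r ?nnegrE ?sqr_ge0 //; last exact: avg_sqr.
    by apply: avg_ge0 => x; exact: sqr_ge0.
  exact: (ndeg_sqr_wsq _ (@adj_sym _)).
have var : (fun n => avg (fun x => `|d n x - p| ^+ 2)) @ \oo --> 0.
  have -> : 0 = p ^+ 2 - 2 * p * p + p ^+ 2 by ring.
  have -> : (fun n => avg (fun x => `|d n x - p| ^+ 2)) =
      (fun n => avg (fun x => d n x ^+ 2) - 2 * p * avg (d n) + p ^+ 2).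
    apply: funext => n; rewrite -avgZ -avgB -[X in _ = _ + X](@avg_const _ (G n)) // -avgD.
    by apply: eq_avg => x; rewrite real_normK ?num_real //; ring.
  apply: cvgD; last exact: cvg_cst.
  by apply: cvgB => //; apply: cvgM => //; exact: cvg_cst.
have dev : (fun n => avg (fun x => `|d n x - p|)) @ \oo --> 0.
  apply: (@cvg_root 1) => //; first by move=> n; apply: avg_ge0.
  rewrite expr0n /=; apply: (cvg_squeeze0 _ var) => n.
  by rewrite ger0_norm ?sqr_ge0 //; apply: avg_sqr.
have walk j : (fun n => awalk R (@adj (G n)) j) @ \oo --> p ^+ j.
  elim: j => [|j IH].
    by under eq_fun do rewrite awalk0 //; exact: cvg_cst.
  rewrite exprS; apply: (cvg_diff0 (cvgM (cvg_cst p) IH)).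
  by apply: (cvg_squeeze0 _ dev) => n; apply: awalkS => //; exact: adj_sym.
pose q := p ^+ k.+1.
have dev2 : (fun n => avg (fun x => avg (fun y => (nwalk R (@adj (G n)) k x y - q) ^+ 2)))
    @ \oo --> 0.
  have -> : 0 = p ^+ (2 * k.+1) - 2 * q * p ^+ k.+1 + q ^+ 2.
    by rewrite mulnC exprM /q; ring.
  under eq_fun do rewrite avg_dev_sqr //.
  apply: cvgD; last exact: cvg_cst.
  by apply: cvgB => //; apply: cvgM; [exact: cvg_cst|exact: walk].
apply/cvgrPdist_le => e e0.
pose m : R := #|edges H|%:R + 1.
have m0 : 0 < m by rewrite /m ltr_wpDl.
have e'0 : 0 < e / m / 2 by rewrite !divr_gt0.
have /cvgrPdist_le/(_ _ e'0) near1 := dev.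
have /cvgrPdist_le/(_ _ (exprn_gt0 (2 * k.+1) e'0)) near2 := dev2.
near=> n.
rewrite distrC; apply: (@le_trans _ _ (#|edges H|%:R * (e / m))); last first.
  by rewrite mulrCA -[leRHS]mulr1 ler_wpM2l ?(ltW e0) // ler_pdivrMr // mul1r /m lerDl.
apply: counting_lemma => //; [exact: adj_sym|by rewrite divr_ge0 ?ltW|].
move=> u v u01 v01.
have -> : e / m = e / m / 2 + e / m / 2 by field; rewrite gt_eqF.
apply: le_trans.
  apply: (@cut_bound _ _ _ (@adj_sym _) (G0 n) p q k u v (e / m / 2)) => //.
    exact: ltW.
  have : `|0 - avg (fun x => avg (fun y => (nwalk R (@adj (G n)) k x y - q) ^+ 2))|
    <= (e / m / 2) ^+ (2 * k.+1) by near: n.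
  by rewrite sub0r normrN; apply: le_trans; exact: ler_norm.
rewrite lerD2l.
have : `|0 - avg (fun x => `|d n x - p|)| <= e / m / 2 by near: n.
by rewrite sub0r normrN; apply: le_trans; exact: ler_norm.
Unshelve. all: by end_near.
Qed.

End Limits.

(** * Densities as moments *)

Section NormalisedCounts.
Local Open Scope ring_scope.
Variables (R : realType) (T : sgraph) (z : T) (V : finType) (A : rel V).
Hypotheses (Asym : symmetric A) (V0 : (0 < #|V|)%N).
Local Notation n := (#|V|%:R : R).
Local Notation d := (ndeg R A).
Local Notation N := #|T|.

Definition nrhom (v : V) : R := (rhom z A v)%:R / n ^+ N.-1.
Local Notation f := nrhom.

Let n0 : n != 0. Proof. by rewrite pnatr_eq0 -lt0n. Qed.
Let N0 : (0 < N)%N. Proof. by apply/card_gt0P; exists z. Qed.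

Lemma rhom_le v : (rhom z A v <= #|V| ^ N.-1)%N.
Proof.
rewrite -(leq_pmul2r V0) -expnSr prednK // -card_ffun.
apply: (@leq_trans (\sum_(g : {ffun T -> V}) \sum_(a : V) (g z == v))%N).
  rewrite /rhom -sum1_card big_distrl big_mkcond /=; apply: leq_sum => g _.
  case: ifP => // ; rewrite inE => /andP[_ /eqP ->].
  by rewrite eqxx sum_nat_const muln1 mul1n.
rewrite -(big_upd addn z (fun g => (g z == v) : nat)) -sum1_card; apply: leq_sum => g _.
rewrite (bigD1 v) //= big1 ?addn0; first by case: eqP.
by move=> a av; rewrite ffunE eqxx (negPf av).
Qed.

Lemma nrhom_ge0 v : 0 <= f v. Proof. by rewrite divr_ge0 ?exprn_ge0. Qed.
Lemma nrhom_le1 v : f v <= 1.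
Proof.
by rewrite ler_pdivrMr ?exprn_gt0 ?ltr0n // mul1r -natrX ler_nat rhom_le.
Qed.

Lemma rhomR v : (rhom z A v)%:R = f v * n ^+ N.-1.
Proof. by rewrite divfK // expf_neq0. Qed.
Lemma degR v : (deg A v)%:R = d v * n.
Proof. by rewrite ndegE divfK. Qed.
Lemma walksR k v w : (walks A k.+1 v w)%:R = nwalk R A k v w * n ^+ k.
Proof. by rewrite divfK // expf_neq0. Qed.

Lemma avg_of_sum (c : V -> nat) (g : V -> R) a m :
  (forall v, (c v)%:R = g v * n ^+ a) -> m = a.+1 ->
  (\sum_v c v)%:R / n ^+ m = avg g.
Proof.
move=> cg ->; rewrite natr_sum (eq_bigr _ (fun v _ => cg v)) -mulr_suml exprS /avg.
by field; rewrite n0 expf_neq0.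
Qed.

Lemma avg_of_sum2 (c : V -> V -> nat) (g : V -> V -> R) a m :
  (forall v w, (c v w)%:R = g v w * n ^+ a) -> m = a.+2 ->
  (\sum_v \sum_w c v w)%:R / n ^+ m = avg (fun v => avg (g v)).
Proof.
move=> cg mE; apply: (@avg_of_sum _ _ a.+1) mE => v.
by rewrite -(@avg_of_sum (c v) (g v) a a.+1) // divfK // expf_neq0.
Qed.

Lemma tdens_T : tdens R A T = avg f.
Proof.
rewrite /tdens (hom_T z); apply: (@avg_of_sum _ _ N.-1); first exact: rhomR.
by rewrite prednK.
Qed.

Lemma tdens_edge : tdens R A edge_graph = avg d.
Proof.
rewrite /tdens card_homs_edge_graph // card_bool; apply: (@avg_of_sum _ _ 1) => // v.
by rewrite degR.
Qed.

Lemma tdens_T' : tdens R A (T' z) = avg (fun v => f v * d v).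
Proof.
rewrite /tdens (hom_T' _ Asym) card_T'; apply: (@avg_of_sum _ _ N); last by lia.
move=> v; rewrite natrM rhomR degR -[in n ^+ N](prednK N0) exprSr; ring.
Qed.

Lemma tdens_edge_double : tdens R A (edge_double z) = avg (fun v => f v ^+ 2 * d v).
Proof.
rewrite /tdens (hom_edge_double _ Asym) card_edge_double.
apply: (@avg_of_sum _ _ (N.-1 * 2).+1%N); last by lia.
by move=> v; rewrite natrM natrX rhomR degR [n ^+ _.+1]exprSr [n ^+ (_ * _)]exprM; ring.
Qed.

Lemma tdens_C4_quad : tdens R A (C4_quad z) =
  avg (fun v => avg (fun w => f v ^+ 4 * f w ^+ 4 * nwalk R A 1 v w ^+ 2)).
Proof.
rewrite /tdens (hom_C4_quad _ Asym); under eq_bigr => v _ do rewrite big_distrr.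
apply: (@avg_of_sum2 _ _ (N.-1 * 8).+2%N); last by have := card_C4_quad z; lia.
move=> v w; cbv beta; rewrite natrM natrX natrM natrX natrX !rhomR walksR expr1.
rewrite [n ^+ _.+2]exprSr [n ^+ _.+1]exprSr [n ^+ (_ * _)]exprM; ring.
Qed.

Lemma tdens_C4_pendants : tdens R A (C4_pendants z) =
  avg (fun v => avg (fun w => (f v * d v ^+ N) ^+ 2 * (f w * d w ^+ N) ^+ 2 *
    nwalk R A 1 v w ^+ 2)).
Proof.
rewrite /tdens (hom_C4_pendants _ Asym); under eq_bigr => v _ do rewrite big_distrr.
apply: (@avg_of_sum2 _ _ (N.-1 * 4 + N * 4).+2%N); last by have := card_C4_pendants z; lia.
move=> v w; cbv beta; rewrite natrM natrX natrM natrX natrM natrX natrM natrX natrX.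
rewrite !rhomR !degR walksR expr1.
rewrite [n ^+ _.+2]exprSr [n ^+ _.+1]exprSr exprD ![n ^+ (_ * _)]exprM.
by rewrite !exprMn; ring.
Qed.

Lemma tdens_cycle : tdens R A (cycle_graph (2 * N)%N) = wsq R A N.-1.
Proof.
rewrite /tdens card_homs_cycle_double // card_ord /wsq.
apply: (@avg_of_sum2 _ _ (N.-1 * 2)%N); last by lia.
by move=> v w; rewrite natrX -[in walks A N](prednK N0) walksR [n ^+ (_ * _)]exprM; ring.
Qed.

Lemma avg_wCS (w g h : V -> R) : (forall x, 0 <= w x) ->
  avg (fun x => w x * (g x * h x)) ^+ 2 <=
  avg (fun x => w x * g x ^+ 2) * avg (fun x => w x * h x ^+ 2).
Proof.
move=> w0; have := avg_CS (fun x => Num.sqrt (w x) * g x) (fun x => Num.sqrt (w x) * h x).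
have E a b x : (Num.sqrt (w x) * a) * (Num.sqrt (w x) * b) = w x * (a * b) :> R.
  by rewrite mulrACA -expr2 sqr_sqrtr.
by under eq_avg => x do rewrite E; under [X in _ <= X * _]eq_avg => x do rewrite expr2 E;
   under [X in _ <= _ * X]eq_avg => x do rewrite expr2 E.
Qed.

(** Expanding the squared codegree, the right-hand side is the mean over u, u' of the
    square of E_v[F(v) A(v,u) A(v,u')], and the mean of the expression being squared
    is E[F d^2]. *)
Lemma glued_C4_ge (F : V -> R) :
  avg (fun v => F v * d v ^+ 2) ^+ 2 <=
  avg (fun v => avg (fun w => F v * F w * nwalk R A 1 v w ^+ 2)).
Proof.
pose a u v : R := (A u v)%:R.
pose h u u' := avg (fun v => F v * (a v u * a v u')).
have dE v : d v = avg (a v) by apply: eq_avg => u; rewrite mulr1.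
have wE v w : nwalk R A 1 v w = avg (fun u => a v u * a w u).
  by rewrite nwalkS // ; apply: eq_avg => u; rewrite nwalk0 /a Asym [A u w]Asym [A u v]Asym.
have sqr_avg (g : V -> R) : avg g ^+ 2 = avg (fun u => avg (fun u' => g u * g u')).
  by rewrite expr2 -avgZr; apply: eq_avg => u; rewrite avgZ.
have -> : avg (fun v => F v * d v ^+ 2) = avg (fun u => avg (h u)).
  transitivity (avg (fun v => avg (fun u => avg (fun u' => F v * (a v u * a v u'))))).
    apply: eq_avg => v; rewrite dE sqr_avg -avgZ; apply: eq_avg => u; rewrite -avgZ //.
  by rewrite avg_exchange; apply: eq_avg => u; rewrite avg_exchange.
have -> : avg (fun v => avg (fun w => F v * F w * nwalk R A 1 v w ^+ 2)) =
   avg (fun u => avg (fun u' => h u u' ^+ 2)).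
  transitivity (avg (fun v => avg (fun w => avg (fun u => avg (fun u' =>
     (F v * (a v u * a v u')) * (F w * (a w u * a w u'))))))).
    apply: eq_avg => v; apply: eq_avg => w; rewrite wE sqr_avg -avgZ.
    by apply: eq_avg => u; rewrite -avgZ; apply: eq_avg => u'; ring.
  under eq_avg => v do rewrite avg_exchange.
  rewrite avg_exchange; apply: eq_avg => u.
  under eq_avg => v do rewrite avg_exchange.
  rewrite avg_exchange; apply: eq_avg => u'.
  by rewrite sqr_avg.
apply: le_trans (avg_sqr V0 _) _; apply: ler_avg => u; exact: avg_sqr.
Qed.

Lemma glued_C4_near (F : V -> R) (c : R) :
  (forall v, 0 <= F v <= 1) -> 0 <= c <= 1 ->
  `|avg (fun v => avg (fun w => F v * F w * nwalk R A 1 v w ^+ 2)) - c ^+ 2 * wsq R A 1|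
  <= 2 * avg (fun v => `|F v - c|).
Proof.
move=> F01 c01.
have -> : c ^+ 2 * wsq R A 1 = avg (fun v => avg (fun w => c ^+ 2 * nwalk R A 1 v w ^+ 2)).
  by rewrite /wsq -avgZ; apply: eq_avg => v; rewrite avgZ.
rewrite -avgB.
have -> : 2 * avg (fun v => `|F v - c|) =
   avg (fun v => avg (fun w => `|F v - c| + `|F w - c|)).
  under [RHS]eq_avg => v do rewrite avgD avg_const //.
  by rewrite avgD avg_const //; ring.
apply: le_trans (avg_norm _) _; apply: ler_avg => v; rewrite -avgB.
apply: le_trans (avg_norm _) _; apply: ler_avg => w; rewrite -mulrBl normrM.
have /andP[F0 F1] := F01 v; have /andP[c0 c1] := c01.
apply: (@le_trans _ _ `|F v * F w - c ^+ 2|).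
  rewrite -[leRHS]mulr1 ler_wpM2l // ger0_norm ?sqr_ge0 // exprn_ile1 ?nwalk_le1 //.
  exact: nwalk_ge0.
have -> : F v * F w - c ^+ 2 = c * (F v - c) + F v * (F w - c) by ring.
apply: le_trans (ler_normD _ _) _; rewrite !normrM (ger0_norm c0) (ger0_norm F0).
by apply: lerD; rewrite -[leRHS]mul1r ler_wpM2r.
Qed.

End NormalisedCounts.

(** * The three families are forcing *)

Section Forcing.
Local Open Scope classical_set_scope.
Local Open Scope ring_scope.
Variable R : realType.

(** Boundedness of u allows to compare u w with u b, so that no division by w n, which
    may vanish, is needed. *)
Lemma cvg_div (u w : nat -> R) (a b : R) : b != 0 -> (forall n, `|u n| <= 1) ->
  (fun n => u n * w n) @ \oo --> a * b -> w @ \oo --> b -> u @ \oo --> a.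
Proof.
move=> b0 u1 uw wb.
have ub : (fun n => u n * b) @ \oo --> a * b.
  apply: (cvg_diff0 uw); apply: (@cvg_squeeze0 _ _ (fun n => `|b - w n|)).
    by move=> n; rewrite -mulrBr normrM -[leRHS]mul1r ler_wpM2r.
  rewrite -(normr0 R) -(subrr b); apply: cvg_norm; apply: cvgB => //; exact: cvg_cst.
have -> : u = (fun n => u n * b * b^-1) by apply: funext => n; rewrite mulfK.
by rewrite -[a](mulfK b0); apply: cvgM => //; exact: cvg_cst.
Qed.

Lemma avg_exp_near k (V : finType) (g : V -> R) (c : R) :
  (forall x, 0 <= g x <= 1) -> 0 <= c <= 1 ->
  avg (fun x => `|g x ^+ k - c ^+ k|) <= k%:R * avg (fun x => `|g x - c|).
Proof.
move=> g01 /andP[c0 c1]; rewrite -avgZ; apply: ler_avg => x; have /andP[g0 g1] := g01 x.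
elim: k => [|k IH]; first by rewrite !expr0 subrr normr0 mul0r.
have -> : g x ^+ k.+1 - c ^+ k.+1 = g x ^+ k * (g x - c) + c * (g x ^+ k - c ^+ k).
  by rewrite !exprSr; ring.
apply: le_trans (ler_normD _ _) _; rewrite -natr1 mulrDl mul1r addrC !normrM.
rewrite (ger0_norm c0) (ger0_norm (exprn_ge0 _ g0)); apply: lerD.
  by apply: le_trans IH; rewrite -[leRHS]mul1r ler_wpM2r.
by rewrite -[leRHS]mul1r ler_wpM2r // exprn_ile1.
Qed.

Lemma sqr_diff_le1 (a b : R) : 0 <= a <= 1 -> 0 <= b <= 1 -> (a - b) ^+ 2 <= 1.
Proof.
by move=> ? ?; rewrite -real_normK ?num_real // exprn_ile1 // ler_norml; lra.
Qed.

Section Sequence.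
Variables (G : nat -> sgraph) (p : R) (T : sgraph) (z : T).
Hypotheses (G0 : forall n, (0 < #|G n|)%N) (p01 : 0 < p < 1).
Local Notation A n := (@adj (G n)).
Local Notation d n := (ndeg R (A n)).
Local Notation f n := (nrhom R z (A n)).
Let As n : symmetric (A n) := @adj_sym (G n).
Let N := #|T|.
Let M := #|edges T|.
Let p0 : 0 < p. Proof. by case/andP: p01. Qed.
Let p1 : p < 1. Proof. by case/andP: p01. Qed.
Let N0 : (0 < N)%N. Proof. by apply/card_gt0P; exists z. Qed.

Let d0 n x : 0 <= d n x. Proof. exact: ndeg_ge0. Qed.
Let d1 n x : d n x <= 1. Proof. exact: ndeg_le1. Qed.
Let f0 n x : 0 <= f n x. Proof. exact: nrhom_ge0. Qed.
Let f1 n x : f n x <= 1. Proof. exact: nrhom_le1. Qed.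
Let px k : 0 <= p ^+ k <= 1. Proof. by rewrite exprn_ge0 ?exprn_ile1 ?ltW. Qed.
Let pn0 k : p ^+ k != 0. Proof. by rewrite expf_neq0 // gt_eqF. Qed.

Definition tends F (l : R) := (fun n => tdens R (@adj (G n)) F) @ \oo --> l.

Lemma cvg_L2_L1 (g : forall n, G n -> R) (c : R) :
  (fun n => avg (fun x => (g n x - c) ^+ 2)) @ \oo --> 0 ->
  (fun n => avg (fun x => `|g n x - c|)) @ \oo --> 0.
Proof.
move=> h; apply: (@cvg_root _ 1) => //; first by move=> n; apply: avg_ge0.
rewrite expr0n /=; apply: (cvg_squeeze0 _ h) => n.
rewrite ger0_norm ?sqr_ge0 //; apply: le_trans (avg_sqr (G0 n) _) _.
by apply: ler_avg => x; rewrite real_normK ?num_real.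
Qed.

Lemma avg_dev (n : nat) (g : G n -> R) (c : R) :
  avg (fun x => (g x - c) ^+ 2) = avg (fun x => g x ^+ 2) - 2 * c * avg g + c ^+ 2.
Proof.
rewrite -(avgZ (2 * c)) -avgB -[X in _ = _ + X](@avg_const R (G n)) // -avgD.
by apply: eq_avg => x; ring.
Qed.

Lemma cvg_dev (g : forall n, G n -> R) (c : R) :
  (fun n => avg (g n)) @ \oo --> c ->
  (fun n => avg (fun x => g n x ^+ 2)) @ \oo --> c ^+ 2 ->
  (fun n => avg (fun x => `|g n x - c|)) @ \oo --> 0.
Proof.
move=> h1 h2; apply: cvg_L2_L1; under eq_fun do rewrite avg_dev.
have -> : 0 = c ^+ 2 - 2 * c * c + c ^+ 2 by ring.
apply: cvgD; last exact: cvg_cst.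
by apply: cvgB => //; apply: cvgM => //; exact: cvg_cst.
Qed.

Lemma cvg_avg_le (u v : nat -> R) : (forall n, 0 <= u n <= v n) ->
  v @ \oo --> 0 -> u @ \oo --> 0.
Proof.
move=> uv v0; apply: (cvg_squeeze0 _ v0) => n.
by have /andP[u0 ?] := uv n; rewrite ger0_norm.
Qed.

(** Weights that are close to a constant in the mean can be replaced by it, because
    all the other factors are bounded by 1. *)
Lemma unweighted_C4 (F : forall n, G n -> R) (c : R) :
  (forall n x, 0 <= F n x <= 1) -> 0 < c <= 1 ->
  (fun n => avg (fun x => `|F n x - c|)) @ \oo --> 0 ->
  (fun n => avg (fun v => avg (fun w => F n v * F n w * nwalk R (A n) 1 v w ^+ 2)))
    @ \oo --> c ^+ 2 * p ^+ 4 ->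
  (fun n => wsq R (A n) 1) @ \oo --> p ^+ 4.
Proof.
move=> F01 /andP[c0 c1] Fc QF.
have h : (fun n => c ^+ 2 * wsq R (A n) 1) @ \oo --> c ^+ 2 * p ^+ 4.
  apply: (cvg_diff0 QF).
  apply: (@cvg_squeeze0 _ _ (fun n => 2 * avg (fun x => `|F n x - c|))) => [n|].
    by rewrite distrC; apply: glued_C4_near => //; rewrite (ltW c0).
  by rewrite -(mulr0 2); apply: cvgM => //; exact: cvg_cst.
have c2 : c ^+ 2 != 0 by rewrite expf_neq0 // gt_eqF.
have -> : (fun n => wsq R (A n) 1) = (fun n => (c ^+ 2)^-1 * (c ^+ 2 * wsq R (A n) 1)).
  by apply: funext => n; rewrite mulKf.
by rewrite -[p ^+ 4](mulKf c2); apply: cvgM => //; exact: cvg_cst.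
Qed.

(** With x = E[d], y = E[f d] and u = E[f^2 d], the inequalities
    y^2 <= x u and x^(2N) <= t(C_2N) squeeze x u to p^(2M+2). *)
Lemma forcing_H1 : tends (T' z) (p ^+ (M + 1)) -> tends (edge_double z) (p ^+ (2 * M + 1)) ->
  tends (cycle_graph (2 * N)) (p ^+ (2 * N)) ->
  forall H, tends H (p ^+ #|edges H|).
Proof.
rewrite /tends; under eq_fun do rewrite tdens_T' //; move=> hT'.
under eq_fun do rewrite tdens_edge_double //; move=> hD.
under eq_fun do rewrite (tdens_cycle R z) //; move=> hC.
have hC' : (fun n => wsq R (A n) N.-1) @ \oo --> p ^+ (2 * N.-1.+1) by rewrite prednK.
apply: (quasirandom_criterion (k := N.-1)) => //; first by rewrite !ltW.
pose x n := avg (d n); pose y n := avg (fun v => f n v * d n v).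
pose u n := avg (fun v => f n v ^+ 2 * d n v).
have x0 n : 0 <= x n by apply: avg_ge0.
have u0 n : 0 <= u n by apply: avg_ge0 => v; rewrite mulr_ge0 ?sqr_ge0.
have yux n : y n ^+ 2 <= x n * u n.
  have -> : y n = avg (fun v => d n v * (f n v * 1)) by apply: eq_avg => v; ring.
  have -> : x n = avg (fun v => d n v * 1 ^+ 2) by apply: eq_avg => v; ring.
  have -> : u n = avg (fun v => d n v * f n v ^+ 2) by apply: eq_avg => v; ring.
  by rewrite mulrC; apply: avg_wCS.
change (x @ \oo --> p); apply: (@cvg_div _ u _ (p ^+ (2 * M + 1))) => //.
  by move=> n; rewrite (ger0_norm (x0 n)); apply: (avg_le1 (G0 n) (@d1 n)).
apply: (@cvg_root _ (2 * N).-1) => //; first by rewrite mulr_ge0 ?exprn_ge0 ?ltW.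
  by move=> n; rewrite mulr_ge0.
rewrite prednK ?muln_gt0 // [in X in _ --> X]exprMn [in X in _ --> X]mulrC.
apply: (@cvg_squeeze _ (fun n => (y n ^+ 2) ^+ (2 * N)) _
  (fun n => u n ^+ (2 * N) * wsq R (A n) N.-1)).
- move=> n; apply/andP; split.
    by apply: lerXn2r; rewrite ?nnegrE ?sqr_ge0 ?(mulr_ge0 (x0 n) (u0 n)).
  rewrite exprMn mulrC ler_wpM2l ?exprn_ge0 //.
  by rewrite -[in leLHS](prednK N0); exact: avg_ndeg_wsq.
- rewrite -exprMn -exprSr (_ : (2 * M + 1).+1 = (M + 1) * 2)%N; last by lia.
  by rewrite [p ^+ (_ * _)]exprM; apply: cvgXn; apply: cvgXn.
- by apply: cvgM => //; apply: cvgXn.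
Qed.

(** Log-convexity of the moments of d for the measure with density f. *)
Lemma moment_CS n (k : nat) :
  avg (fun v => f n v * d n v ^+ k.+1) ^+ 2 <=
  avg (fun v => f n v * d n v ^+ k) * avg (fun v => f n v * d n v ^+ k.+2).
Proof.
have w0 v : 0 <= f n v * d n v ^+ k by rewrite mulr_ge0 ?exprn_ge0.
have -> : avg (fun v => f n v * d n v ^+ k.+1) =
    avg (fun v => f n v * d n v ^+ k * (1 * d n v)).
  by apply: eq_avg => v; rewrite exprSr; ring.
have -> : avg (fun v => f n v * d n v ^+ k.+2) =
    avg (fun v => f n v * d n v ^+ k * d n v ^+ 2).
  by apply: eq_avg => v; rewrite -addn2 exprD; ring.
have -> : avg (fun v => f n v * d n v ^+ k) = avg (fun v => f n v * d n v ^+ k * 1 ^+ 2).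
  by apply: eq_avg => v; ring.
exact: avg_wCS.
Qed.

Lemma tends_of_C4 : (fun n => avg (d n)) @ \oo --> p ->
  (fun n => wsq R (A n) 1) @ \oo --> p ^+ 4 -> forall H, tends H (p ^+ #|edges H|).
Proof. by move=> h1 h2; apply: (quasirandom_criterion (k := 1)) => //; rewrite !ltW. Qed.

(** With u = E[f^2 d], one has (E[f d])^2 <= E[d] u and
    u^4 <= E[(f^2 d)^2]^2 <= t, where t is the density of the weighted C_4. Everything
    is tight in the limit, so f^2 d tends to the constant p^(2M+1) in L2, and f tends to
    p^M where d does not vanish; the former says that d hardly ever vanishes. *)
Lemma forcing_H2 : tends edge_graph p -> tends (T' z) (p ^+ (M + 1)) ->
  tends (C4_quad z) (p ^+ (8 * M + 4)) -> forall H, tends H (p ^+ #|edges H|).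
Proof.
rewrite /tends; under eq_fun do rewrite tdens_edge //; move=> hx.
under eq_fun do rewrite tdens_T' //; move=> hy.
under eq_fun do rewrite tdens_C4_quad //; move=> hQ.
apply: tends_of_C4 => //.
pose q := p ^+ M; pose c := p ^+ (2 * M + 1).
have cE : c = q ^+ 2 * p by rewrite /c /q addn1 exprSr mulnC exprM.
pose x n := avg (d n); pose y n := avg (fun v => f n v * d n v).
pose g n v := f n v ^+ 2 * d n v.
pose u n := avg (g n); pose t n := avg (fun v => g n v ^+ 2).
pose Q n := avg (fun v => avg (fun w => f n v ^+ 4 * f n w ^+ 4 * nwalk R (A n) 1 v w ^+ 2)).
have g0 n v : 0 <= g n v by rewrite mulr_ge0 ?sqr_ge0.
have g1 n v : g n v <= 1 by rewrite mulr_ile1 ?exprn_ge0 ?exprn_ile1.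
have x0 n : 0 <= x n by apply: avg_ge0.
have u0 n : 0 <= u n by apply: avg_ge0.
have t0 n : 0 <= t n by apply: avg_ge0 => v; exact: sqr_ge0.
have xu0 n : 0 <= x n * u n := mulr_ge0 (x0 n) (u0 n).
have yux n : y n ^+ 2 <= x n * u n.
  have -> : y n = avg (fun v => d n v * (f n v * 1)) by apply: eq_avg => v; ring.
  have -> : x n = avg (fun v => d n v * 1 ^+ 2) by apply: eq_avg => v; ring.
  have -> : u n = avg (fun v => d n v * f n v ^+ 2) by apply: eq_avg => v; rewrite /g; ring.
  by rewrite mulrC; apply: avg_wCS.
have u2t n : u n ^+ 2 <= t n by apply: avg_sqr.
have t2Q n : t n ^+ 2 <= Q n.
  have -> : t n = avg (fun v => f n v ^+ 4 * d n v ^+ 2) by apply: eq_avg => v; rewrite /g; ring.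
  exact: (glued_C4_ge (@As n) (G0 n) (fun v => f n v ^+ 4)).
have u4t n : u n ^+ 4 <= t n ^+ 2.
  by rewrite -[4%N]/(2 * 2)%N exprM; apply: lerXn2r; rewrite ?nnegrE ?sqr_ge0 ?t0 ?u2t.
have hxu : (fun n => x n * u n) @ \oo --> p * c.
  apply: (@cvg_root _ 3) => //; first by rewrite mulr_ge0 ?exprn_ge0 ?ltW.
  apply: (@cvg_squeeze _ (fun n => (y n ^+ 2) ^+ 4) _ (fun n => x n ^+ 4 * Q n)).
  - move=> n; apply/andP; split.
      by apply: lerXn2r; rewrite ?nnegrE ?sqr_ge0 ?xu0 ?yux.
    rewrite exprMn; apply: ler_wpM2l; first exact: exprn_ge0.
    exact: le_trans (u4t n) (t2Q n).
  - have -> : p * c = (p ^+ (M + 1)) ^+ 2.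
      by rewrite /c -exprM -exprS; congr (_ ^+ _); lia.
    by apply: cvgXn; apply: cvgXn.
  - have -> : (p * c) ^+ 4 = p ^+ 4 * p ^+ (8 * M + 4).
      by rewrite exprMn /c -exprM; congr (_ * _ ^+ _); lia.
    by apply: cvgM => //; apply: cvgXn.
have hu : u @ \oo --> c.
  apply: (@cvg_div _ x _ p) => //; first by rewrite gt_eqF.
    by move=> n; rewrite ger0_norm //; apply: (avg_le1 (G0 n) (g1 n)).
  rewrite mulrC; have -> // : (fun n => u n * x n) = (fun n => x n * u n).
  by apply: funext => n; rewrite mulrC.
have ht : t @ \oo --> c ^+ 2.
  apply: (@cvg_root _ 1) => //; first exact: sqr_ge0.
  apply: (@cvg_squeeze _ (fun n => u n ^+ 4) _ Q).
  - by move=> n; rewrite u4t t2Q.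
  - by rewrite -exprM; apply: cvgXn.
  - by have -> : (c ^+ 2) ^+ 2 = p ^+ (8 * M + 4) by rewrite /c -!exprM; congr (_ ^+ _); lia.
have hs : (fun n => avg (fun v => `|g n v - c|)) @ \oo --> 0 by apply: cvg_dev.
(* f tends to q = p^M for the measure with density d. *)
have hw : (fun n => avg (fun v => (f n v - q) ^+ 2 * d n v)) @ \oo --> 0.
  have -> : (fun n => avg (fun v => (f n v - q) ^+ 2 * d n v)) =
      (fun n => u n - 2 * q * y n + q ^+ 2 * x n).
    apply: funext => n; rewrite /u /y /x -!avgZ -avgB -avgD.
    by apply: eq_avg => v; rewrite /g; ring.
  have -> : 0 = c - 2 * q * p ^+ (M + 1) + q ^+ 2 * p.
    have alg (a b : R) : 0 = a ^+ 2 * b - 2 * a * (a * b) + a ^+ 2 * b by ring.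
    rewrite cE (_ : p ^+ (M + 1) = q * p); first exact: alg.
    by rewrite addn1 exprSr.
  apply: cvgD; last by apply: cvgM => //; exact: cvg_cst.
  by apply: cvgB => //; apply: cvgM => //; exact: cvg_cst.
have c0 : 0 < c by rewrite exprn_gt0.
(* The factor c is bounded by g + |g - c| with g = f^2 d <= d, which reduces the plain
   measure to the one with density d. *)
have hf : (fun n => avg (fun v => `|f n v - q|)) @ \oo --> 0.
  apply: (@cvg_L2_L1 (fun n => f n)).
  apply: (@cvg_avg_le _ (fun n => c^-1 * (avg (fun v => (f n v - q) ^+ 2 * d n v) +
     avg (fun v => `|g n v - c|)))) => [n|]; last first.
    rewrite -(mulr0 c^-1); apply: cvgM; first exact: cvg_cst.
    by rewrite -[0]addr0; apply: cvgD.
  apply/andP; split; first by apply: avg_ge0 => v; exact: sqr_ge0.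
  rewrite -avgD ler_pdivlMl // -avgZ; apply: ler_avg => v.
  have fq1 : (f n v - q) ^+ 2 <= 1.
    by apply: sqr_diff_le1; [rewrite f0 f1|exact: (px M)].
  have -> : c * (f n v - q) ^+ 2 =
     (f n v - q) ^+ 2 * g n v + (f n v - q) ^+ 2 * (c - g n v) by ring.
  apply: lerD.
    rewrite ler_wpM2l ?sqr_ge0 // /g -[leRHS]mul1r ler_wpM2r //.
    by rewrite exprn_ile1.
  apply: (@le_trans _ _ ((f n v - q) ^+ 2 * `|g n v - c|)).
    by rewrite ler_wpM2l ?sqr_ge0 // distrC ler_norm.
  by rewrite -[leRHS]mul1r ler_wpM2r.
apply: (@unweighted_C4 (fun n v => f n v ^+ 4) (q ^+ 4)).
- by move=> n v; rewrite exprn_ge0 ?exprn_ile1.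
- by rewrite !exprn_gt0 // exprn_ile1 ?exprn_ge0 ?exprn_ile1 // ltW.
- apply: (@cvg_avg_le _ (fun n => 4%:R * avg (fun v => `|f n v - q|))) => [n|].
    apply/andP; split; first exact: avg_ge0.
    by apply: avg_exp_near => [v|]; [rewrite f0 f1|exact: (px M)].
  by rewrite -(mulr0 4); apply: cvgM => //; exact: cvg_cst.
- have -> : (q ^+ 4) ^+ 2 * p ^+ 4 = p ^+ (8 * M + 4).
    by rewrite /q -!exprM -exprD; congr (_ ^+ _); lia.
  exact: hQ.
Qed.

(** With m_k = E[f d^k] and h = f d^(N+1), one has
    m_1^(N+1) <= m_0^N m_(N+1) and m_(N+1)^4 <= E[h^2]^2 <= t, where t is the density of
    the weighted C_4. Tightness shows that h is nearly constant, and by log-convexity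
    that m_2 tends to p^2 m_0; so d is nearly p where f does not vanish, that
    is, almost everywhere. *)
Lemma forcing_H3 : tends T (p ^+ M) -> tends (T' z) (p ^+ (M + 1)) ->
  tends (C4_pendants z) (p ^+ (4 * M + 4 * N + 4)) -> forall H, tends H (p ^+ #|edges H|).
Proof.
rewrite /tends; under eq_fun do rewrite (tdens_T R z) //; move=> hT.
under eq_fun do rewrite tdens_T' //; move=> hT'.
under eq_fun do rewrite tdens_C4_pendants //; move=> hQ.
pose q := p ^+ M; pose c := q * p ^+ N.+1.
pose m k n := avg (fun v => f n v * d n v ^+ k).
pose h n v := f n v * d n v ^+ N.+1.
pose t n := avg (fun v => h n v ^+ 2).
pose Q n := avg (fun v => avg (fun w =>
  (f n v * d n v ^+ N) ^+ 2 * (f n w * d n w ^+ N) ^+ 2 * nwalk R (A n) 1 v w ^+ 2)).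
have q0 : 0 < q by rewrite exprn_gt0.
have c0 : 0 < c by rewrite mulr_gt0 ?exprn_gt0.
have m0 k n : 0 <= m k n by apply: avg_ge0 => v; rewrite mulr_ge0 ?exprn_ge0.
have m1 k n : `|m k n| <= 1.
  rewrite (ger0_norm (m0 k n)); apply: (avg_le1 (G0 n)) => v.
  by rewrite mulr_ile1 ?exprn_ge0 ?exprn_ile1.
have t0 n : 0 <= t n by apply: avg_ge0 => v; exact: sqr_ge0.
have lc n : m 1 n ^+ N.+1 <= m 0 n ^+ N * m N.+1 n.
  by apply: (logconvex_pow (s := fun k => m k n)) => k //; exact: moment_CS.
have lc2 n : m 2 n ^+ N <= m 1 n ^+ N.-1 * m N.+1 n.
  rewrite -[in leLHS](prednK N0) -[in m N.+1 n](prednK N0).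
  by apply: (logconvex_pow (s := fun k => m k.+1 n)) => k //; exact: moment_CS.
have m2t n : m N.+1 n ^+ 2 <= t n by apply: avg_sqr.
have t2Q n : t n ^+ 2 <= Q n.
  have -> : t n = avg (fun v => (f n v * d n v ^+ N) ^+ 2 * d n v ^+ 2).
    by apply: eq_avg => v; rewrite /h [d n v ^+ N.+1]exprSr; ring.
  exact: (glued_C4_ge (@As n) (G0 n) (fun v => (f n v * d n v ^+ N) ^+ 2)).
have m4t n : m N.+1 n ^+ 4 <= t n ^+ 2.
  by rewrite -[4%N]/(2 * 2)%N exprM; apply: lerXn2r; rewrite ?nnegrE ?sqr_ge0 ?t0 ?m2t.
have hm0 : m 0 @ \oo --> q.
  have -> : m 0 = (fun n => avg (f n)); last exact: hT.
  by apply: funext => n; apply: eq_avg => v; rewrite mulr1.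
have hm1 : m 1 @ \oo --> q * p.
  rewrite -[X in _ --> X]/(p ^+ M * p) -exprSr -addn1.
  have -> : m 1 = (fun n => avg (fun v => f n v * d n v)); last exact: hT'.
  by apply: funext => n; apply: eq_avg => v; rewrite expr1.
have cQ : p ^+ (4 * M + 4 * N + 4) = c ^+ 4.
  by rewrite /c /q -exprD -exprM; congr (_ ^+ _); lia.
have qN0 : 0 < q ^+ N by rewrite exprn_gt0.
have hprod : (fun n => m N.+1 n * m 0 n ^+ N) @ \oo --> c * q ^+ N.
  apply: (@cvg_root _ 3); first by rewrite mulr_ge0 // ltW.
    by move=> n; apply: mulr_ge0; rewrite ?exprn_ge0.
  apply: (@cvg_squeeze _ (fun n => (m 1 n ^+ N.+1) ^+ 4) _ (fun n => Q n * (m 0 n ^+ N) ^+ 4)).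
  - move=> n; apply/andP; split.
      apply: lerXn2r; last by rewrite [leRHS]mulrC; exact: lc.
        by rewrite nnegrE exprn_ge0.
      by rewrite nnegrE; apply: mulr_ge0; [exact: m0|rewrite exprn_ge0].
    rewrite exprMn; apply: ler_wpM2r; first by rewrite !exprn_ge0.
    exact: le_trans (m4t n) (t2Q n).
  - have alg (a b : R) k : a * b ^+ k.+1 * a ^+ k = (a * b) ^+ k.+1.
      by rewrite exprMn [a ^+ k.+1]exprS; ring.
    by rewrite alg; apply: cvgXn; apply: cvgXn.
  - by rewrite exprMn -cQ; apply: cvgM => //; apply: cvgXn; apply: cvgXn.
have hmN : m N.+1 @ \oo --> c.
  apply: (@cvg_div _ (fun n => m 0 n ^+ N) _ (q ^+ N)) => //; first by rewrite gt_eqF.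
  exact: cvgXn.
have ht : t @ \oo --> c ^+ 2.
  apply: (@cvg_root _ 1) => //; first exact: sqr_ge0.
  apply: (@cvg_squeeze _ (fun n => m N.+1 n ^+ 4) _ Q).
  - by move=> n; rewrite m4t t2Q.
  - by rewrite -exprM; apply: cvgXn.
  - by rewrite -exprM -cQ.
have hs : (fun n => avg (fun v => `|h n v - c|)) @ \oo --> 0 by apply: cvg_dev.
have hm02 : (fun n => m 2 n * m 0 n) @ \oo --> q * p ^+ 2 * q.
  apply: (@cvg_root _ N.-1); first by rewrite !mulr_ge0 ?exprn_ge0 // ltW.
    by move=> n; apply: mulr_ge0.
  rewrite prednK //.
  apply: (@cvg_squeeze _ (fun n => (m 1 n ^+ 2) ^+ N) _
    (fun n => (m 1 n ^+ N.-1 * m N.+1 n) * m 0 n ^+ N)).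
  - move=> n; apply/andP; split.
      apply: lerXn2r; last by rewrite [leRHS]mulrC; exact: moment_CS.
        by rewrite nnegrE sqr_ge0.
      by rewrite nnegrE; apply: mulr_ge0; exact: m0.
    by rewrite exprMn; apply: ler_wpM2r; rewrite ?exprn_ge0 ?lc2.
  - have alg (a b : R) : a * b ^+ 2 * a = (a * b) ^+ 2 by ring.
    by rewrite alg; apply: cvgXn; apply: cvgXn.
  - have alg (a b : R) k : (a * b ^+ 2 * a) ^+ k.+1 =
        (a * b) ^+ k * (a * b ^+ k.+2) * a ^+ k.+1.
      have -> : a * b ^+ 2 * a = (a * b) * (a * b) by ring.
      by rewrite !exprMn !exprS; ring.
    rewrite -[in X in _ --> X](prednK N0) alg (prednK N0).
    by apply: cvgM; [apply: cvgM => //|]; apply: cvgXn.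
have hm2 : m 2 @ \oo --> q * p ^+ 2.
  by apply: (@cvg_div _ (m 0) _ q) => //; rewrite gt_eqF.
(* d tends to p for the measure with density f. *)
have hw : (fun n => avg (fun v => f n v * (d n v - p) ^+ 2)) @ \oo --> 0.
  have -> : (fun n => avg (fun v => f n v * (d n v - p) ^+ 2)) =
      (fun n => m 2 n - 2 * p * m 1 n + p ^+ 2 * m 0 n).
    apply: funext => n; rewrite /m -!avgZ -avgB -avgD.
    by apply: eq_avg => v; ring.
  have alg (a b : R) : 0 = a * b ^+ 2 - 2 * b * (a * b) + b ^+ 2 * a by ring.
  rewrite (alg q p); apply: cvgD; last by apply: cvgM => //; exact: cvg_cst.
  by apply: cvgB => //; apply: cvgM => //; exact: cvg_cst.
have hd : (fun n => avg (fun v => `|d n v - p|)) @ \oo --> 0.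
  apply: (@cvg_L2_L1 (fun n => d n)).
  apply: (@cvg_avg_le _ (fun n => c^-1 * (avg (fun v => f n v * (d n v - p) ^+ 2) +
     avg (fun v => `|h n v - c|)))) => [n|]; last first.
    rewrite -(mulr0 c^-1); apply: cvgM; first exact: cvg_cst.
    by rewrite -[0]addr0; apply: cvgD.
  apply/andP; split; first by apply: avg_ge0 => v; exact: sqr_ge0.
  rewrite -avgD ler_pdivlMl // -avgZ; apply: ler_avg => v.
  have dp1 : (d n v - p) ^+ 2 <= 1.
    by apply: sqr_diff_le1; rewrite ?d0 ?d1 ?ltW.
  have -> : c * (d n v - p) ^+ 2 =
     h n v * (d n v - p) ^+ 2 + (d n v - p) ^+ 2 * (c - h n v) by ring.
  apply: lerD.
    rewrite ler_wpM2r ?sqr_ge0 // /h -[leRHS]mulr1 ler_wpM2l //.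
    by rewrite exprn_ile1.
  apply: (@le_trans _ _ ((d n v - p) ^+ 2 * `|h n v - c|)).
    by rewrite ler_wpM2l ?sqr_ge0 // distrC ler_norm.
  by rewrite -[leRHS]mul1r ler_wpM2r.
apply: tends_of_C4.
  apply: (cvg_diff0 (cvg_cst p)); apply: (cvg_squeeze0 _ hd) => n.
  have {1}-> : p = avg (fun _ : G n => p) by rewrite avg_const.
  by rewrite -avgB; exact: avg_norm.
have hb : (fun n => avg (fun v => `|f n v * d n v ^+ N - q * p ^+ N|)) @ \oo --> 0.
  apply: (@cvg_avg_le _ (fun n => p^-1 * (avg (fun v => `|h n v - c|) +
     avg (fun v => `|d n v - p|)))) => [n|]; last first.
    rewrite -(mulr0 p^-1); apply: cvgM; first exact: cvg_cst.
    by rewrite -[0]addr0; apply: cvgD.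
  apply/andP; split; first exact: avg_ge0.
  rewrite -avgD ler_pdivlMl // -avgZ; apply: ler_avg => v.
  rewrite -[X in X * _](gtr0_norm p0) -normrM.
  have -> : p * (f n v * d n v ^+ N - q * p ^+ N) =
     (h n v - c) - f n v * d n v ^+ N * (d n v - p).
    have alg (a b e g x y : R) : e * (a * x - b * y) =
       (a * (x * g) - b * (y * e)) - a * x * (g - e) by ring.
    by rewrite /h /c !exprSr; exact: alg.
  apply: le_trans (ler_normB _ _) _; rewrite lerD2l normrM -[leRHS]mul1r ler_wpM2r //.
  by rewrite ger0_norm ?mulr_ge0 ?exprn_ge0 // mulr_ile1 ?exprn_ge0 ?exprn_ile1.
have fd01 n v : 0 <= f n v * d n v ^+ N <= 1.
  apply/andP; split; first by rewrite mulr_ge0 ?exprn_ge0.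
  by rewrite mulr_ile1 ?exprn_ge0 ?exprn_ile1.
have qp01 : 0 <= q * p ^+ N <= 1.
  by rewrite -exprD; exact: (px (M + N)).
apply: (@unweighted_C4 (fun n v => (f n v * d n v ^+ N) ^+ 2) ((q * p ^+ N) ^+ 2)).
- by move=> n v; have /andP[fd0 fd1] := fd01 n v; rewrite sqr_ge0 exprn_ile1.
- by rewrite exprn_gt0 ?mulr_gt0 ?exprn_gt0 // exprn_ile1 //; have /andP[] := qp01.
- apply: (@cvg_avg_le _
    (fun n => 2%:R * avg (fun v => `|f n v * d n v ^+ N - q * p ^+ N|))) => [n|].
    apply/andP; split; first exact: avg_ge0.
    by apply: avg_exp_near => // v; exact: fd01.
  by rewrite -(mulr0 2); apply: cvgM => //; exact: cvg_cst.
- have -> : ((q * p ^+ N) ^+ 2) ^+ 2 * p ^+ 4 = p ^+ (4 * M + 4 * N + 4).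
    by rewrite /q -exprD -!exprM -exprD; congr (_ ^+ _); lia.
  exact: hQ.
Qed.
End Sequence.
End Forcing.

(** * Graphs with prescribed limiting densities *)

Section Parts.
Local Open Scope classical_set_scope.
Local Open Scope ring_scope.
Variables (V : finType) (c : V -> nat) (n : nat).

Let slot : finType := {v : V & 'I_(c v)}.

(** The slots of all parts together are numbered consecutively, and the vertices
    beyond the last slot belong to no part. *)
Definition part (i : 'I_n) : option V :=
  omap tag [pick t : slot | nat_of_ord (enum_rank t) == i].

Lemma card_part (v : V) : (\sum_v c v <= n)%N -> #|[set i | part i == Some v]%SET| = c v.
Proof.
move=> cn; have sz : (#|slot| <= n)%N.
  by apply: leq_trans cn; rewrite card_tagged sumnE big_map big_enum /=;
     under eq_bigr => u _ do rewrite card_ord.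
pose emb (k : 'I_(c v)) : 'I_n := widen_ord sz (enum_rank (Tagged (fun v => 'I_(c v)) k : slot)).
have emb_inj : injective emb.
  move=> k l /(congr1 val) /= /val_inj/enum_rank_inj e.
  by have := eq_from_Tagged e.
have partE (t : slot) : part (widen_ord sz (enum_rank t)) = Some (tag t).
  rewrite /part; case: pickP => [u /eqP/val_inj/enum_rank_inj ->//|/(_ t)].
  by rewrite eqxx.
rewrite -[RHS]card_ord -(card_imset predT emb_inj); apply: eq_card => i.
rewrite inE; apply/eqP/imsetP => [|[k _ ->]]; last by rewrite partE.
rewrite /part; case: (@pickP slot _) => //= -[u k] /eqP ti [uv].
move: k ti; rewrite uv => k ti; exists k => //.
by apply: val_inj.
Qed.

End Parts.

Section Blowup.
Local Open Scope classical_set_scope.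
Local Open Scope ring_scope.
Variables (R : realType) (V : finType) (A : rel V) (w : V -> R).
Hypotheses (Asym : symmetric A) (w0 : forall v, 0 <= w v) (wsum : \sum_v w v <= 2^-1).

(** Rounding down keeps the total below n, see [psize_sum_le]. *)
Definition psize n v : nat := Num.truncn (w v * n%:R).
Definition opt_adj (a b : option V) : bool :=
  if a is Some u then if b is Some v then A u v else false else false.
Definition looped_adj n : rel 'I_n := fun i j => opt_adj (part (psize n) i) (part (psize n) j).
(** A part whose index carries a loop becomes a clique; vertices outside all parts
    are isolated. *)
Definition blowup_adj n : rel 'I_n := fun i j => (i != j) && looped_adj i j.

Lemma looped_adj_sym n : symmetric (@looped_adj n).
Proof. by move=> i j; rewrite /looped_adj; case: part => [u|]; case: part => //= v. Qed.
Lemma blowup_adj_sym n : symmetric (@blowup_adj n).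
Proof. by move=> i j; rewrite /blowup_adj eq_sym looped_adj_sym. Qed.
Lemma blowup_adj_irrefl n : irreflexive (@blowup_adj n).
Proof. by move=> i; rewrite /blowup_adj eqxx. Qed.
Definition blowup n : sgraph := SGraph (@blowup_adj_sym n) (@blowup_adj_irrefl n).

Lemma psize_sum n : (\sum_v psize n v)%:R <= 2^-1 * n%:R :> R.
Proof.
rewrite natr_sum; apply: (@le_trans _ _ (\sum_v w v * n%:R)).
  by apply: ler_sum => v _; rewrite truncn_le mulr_ge0.
by rewrite -mulr_suml ler_wpM2r.
Qed.

Lemma psize_sum_le n : (\sum_v psize n v <= n)%N.
Proof.
rewrite -(ler_nat R); apply: le_trans (psize_sum n) _.
by rewrite ler_piMl // invf_le1 // ler1n.
Qed.

Lemma psize_cvg v : (fun n => (psize n.+1 v)%:R / n.+1%:R) @ \oo --> w v.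
Proof.
apply: (cvg_diff0 (cvg_cst (w v))); apply: (cvg_squeeze0 _ cvg_harmonic) => n.
have n0 : (0 : R) < n.+1%:R by rewrite ltr0n.
have /andP[lo up] := truncn_itv (mulr_ge0 (w0 v) (ltW n0)).
rewrite /harmonic /psize; set t := Num.truncn _ in lo up *.
have -> : t%:R / n.+1%:R - w v = (t%:R - w v * n.+1%:R) * n.+1%:R^-1.
  by field; rewrite addrC natr1 gt_eqF.
rewrite normrM [`|_^-1|]gtr0_norm ?invr_gt0 // -[leRHS]mul1r ler_wpM2r ?invr_ge0 ?(ltW n0) //.
by move: up; rewrite -natr1 ler_norml; lra.
Qed.

Variable H : sgraph.
Hypothesis Hiso : no_isolated H.

(** Vertices of H are never isolated, so their images lie in parts, and choosing a
    homomorphism means choosing the parts first and then a vertex in each of them. *)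
Lemma card_homs_looped n : #|homs H (@looped_adj n)| = \sum_(f in homs H A) \prod_x psize n (f x).
Proof.
transitivity (\sum_(f in homs H A) \sum_(g : {ffun H -> 'I_n})
    \prod_x (part (psize n) (g x) == Some (f x)))%N; last first.
  apply: eq_bigr => f _.
  rewrite -(bigA_distr_bigA (fun x i => (part (psize n) i == Some (f x)) : nat)).
  apply: eq_bigr => x _; rewrite -(card_part (f x) (psize_sum_le n)) -sum1_card [RHS]big_mkcond /=.
  by apply: eq_bigr => i _; rewrite inE; case: (_ == _).
rewrite exchange_big -sum1_card big_mkcond /=; apply: eq_bigr => g _.
have prodE (f : {ffun H -> V}) : (\prod_x (part (psize n) (g x) == Some (f x)) =
    [forall x, part (psize n) (g x) == Some (f x)])%N.
  case: forallP => [h|/forallP]; first by rewrite big1 // => x _; rewrite h.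
  rewrite negb_forall => /existsP[x /negPf e].
  by rewrite (bigD1 x) //= e mul0n.
under [RHS]eq_bigr => f _ do rewrite prodE.
case: ifP => [/homsP h|/negP h].
  have ex x : exists v, part (psize n) (g x) == Some v.
    have [y xy] := Hiso x; have := h _ _ xy; rewrite /looped_adj.
    by case: part => // v _; exists v.
  pose f := [ffun x => xchoose (ex x)].
  have fE x : part (psize n) (g x) = Some (f x)
    by rewrite [f x]ffunE; apply/eqP; exact: (xchooseP (ex x)).
  have fhom : f \in homs H A.
    by apply/homsP => x y /h; rewrite /looped_adj !fE.
  rewrite (bigD1 f) //= big1 ?addn0; first by case: forallP => // -[] x; rewrite fE.
  move=> f' /andP[_ /eqP ff']; case: forallP => // e; case: ff'.
  by apply/ffunP => x; have := e x; rewrite fE => /eqP [].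
rewrite big1 // => f /homsP fh; case: forallP => // e; case: h.
by apply/homsP => x y /fh; rewrite /looped_adj (eqP (e x)) (eqP (e y)).
Qed.

(** A map counted only on the right identifies two vertices of H. *)
Lemma homs_looped_blowup n :
  (#|homs H (@adj (blowup n))| <= #|homs H (@looped_adj n)| <=
   #|homs H (@adj (blowup n))| + #|H| ^ 2 * n ^ #|H|.-1)%N.
Proof.
apply/andP; split.
  apply: subset_leq_card; apply/fintype.subsetP => f /homsP h; apply/homsP => x y /h.
  by case/andP.
pose S (p : H * H) : {set {ffun H -> 'I_n}} :=
  [set f : {ffun H -> 'I_n} | f p.1 == f p.2]%SET.
apply: (@leq_trans (#|homs H (@adj (blowup n))| + \sum_(p : H * H | p.1 != p.2) #|S p|)%N).
  rewrite -!sum1_card big_mkcond [X in (_ <= X + _)%N]big_mkcond /=.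
  under [X in (_ <= _ + X)%N]eq_bigr => p _ do rewrite -sum1_card big_mkcond /=.
  rewrite exchange_big -big_split /=; apply: leq_sum => f _.
  case: ifP => // /homsP h; case: ifP => [|/negP nh]; first by rewrite leq_addr.
  case: (boolP [exists p : H * H, (p.1 != p.2) && (f p.1 == f p.2)]).
    by move=> /existsP[p /andP[p12 fp]]; rewrite (bigD1 p) //= inE fp.
  move=> /existsPn ne; case: nh; apply/homsP => x y xy.
  rewrite /= /blowup_adj h // andbT; have := ne (x, y).
  rewrite negb_and negbK /= => /orP[/eqP e|//].
  by rewrite e adj_irrefl in xy.
rewrite leq_add2l (eq_bigr (fun=> #|'I_n| ^ #|H|.-1)%N); last first.
  by move=> p hp; exact: card_collision.
rewrite card_ord.
rewrite sum_nat_const leq_mul2r; apply/orP; right.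
by rewrite -mulnn -card_prod max_card.
Qed.

Definition pattern_dens : R := \sum_(f in homs H A) \prod_x w (f x).

(** The maps that identify two vertices of H contribute at most |H|^2 / n. *)
Lemma blowup_cvg : (0 < #|H|)%N ->
  (fun n => tdens R (@adj (blowup n.+1)) H) @ \oo --> pattern_dens.
Proof.
move=> H0.
have lim1 : (fun n => tdens R (@looped_adj n.+1) H) @ \oo --> pattern_dens.
  have -> : (fun n => tdens R (@looped_adj n.+1) H) =
     (fun n => \sum_(f in homs H A) \prod_x ((psize n.+1 (f x))%:R / n.+1%:R)).
    apply: funext => n; rewrite /tdens card_homs_looped natr_sum mulr_suml.
    apply: eq_bigr => f _; rewrite natr_prod big_split /= prodr_const card_ord.
    by rewrite exprVn.
  apply: cvg_big => [|f _]; first exact: add_continuous.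
  apply: cvg_big => [|x _]; first exact: mul_continuous.
  exact: psize_cvg.
apply: (cvg_diff0 lim1).
apply: (@cvg_squeeze0 _ _ (fun n => (#|H| ^ 2)%:R * harmonic n)) => [n|]; last first.
  rewrite -(mulr0 (#|H| ^ 2)%:R); apply: cvgM; [exact: cvg_cst|exact: cvg_harmonic].
have /andP[lo up] := homs_looped_blowup n.+1.
rewrite distrC /tdens !card_ord -mulrBl normrM.
rewrite [`|_ - _|]ger0_norm ?subr_ge0 ?ler_nat // ger0_norm ?invr_ge0 ?exprn_ge0 //.
rewrite ler_pdivrMr ?exprn_gt0 ?ltr0n // lerBlDl /harmonic -[in leRHS](prednK H0).
rewrite exprS mulrA -[_ * _^-1 * _]mulrA mulVf ?pnatr_eq0 // mulr1.
by rewrite -natrX -natrM -natrD ler_nat prednK.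
Qed.
End Blowup.

(** * From nearly bipartite graphs to disjoint cliques *)

Section CliqueWeights.
Local Open Scope ring_scope.
Variables (R : realType) (m : nat) (H : sgraph).
Hypothesis m0 : (0 < m)%N.

(** At s = 0 the weights are uniform, at s = 1 one side has disappeared and m disjoint
    cliques remain. The total is always 1/2, the other half being isolated. *)
Definition Kmm_w (s : R) (u : Kmm m) : R := (if u.2 then 1 - s else 1 + s) / (4 * m%:R).
Definition Kmm_dens (s : R) : R := pattern_dens (@Kmm_adj m) (Kmm_w s) H.

Let mR : m%:R != 0 :> R. Proof. by rewrite pnatr_eq0 -lt0n. Qed.
Let mP : 0 < m%:R :> R. Proof. by rewrite ltr0n. Qed.

Lemma Kmm_w_ge0 s u : 0 <= s <= 1 -> 0 <= Kmm_w s u.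
Proof.
move=> /andP[s0 s1]; rewrite divr_ge0 ?mulr_ge0 //.
by case: u.2; rewrite ?subr_ge0 // addr_ge0.
Qed.

Lemma Kmm_w_sum s : \sum_u Kmm_w s u = 2^-1.
Proof.
rewrite -(pair_big xpredT xpredT (fun i b => Kmm_w s (i, b))) /=.
under eq_bigr => i _ do rewrite big_bool /Kmm_w /=.
by rewrite sumr_const card_ord -[_ *+ m]mulr_natr; field.
Qed.

(** Being polynomial in s is what allows to use the intermediate value theorem. *)
Lemma Kmm_dens_poly : exists P : {poly R}, forall s, P.[s] = Kmm_dens s.
Proof.
exists (\sum_(f in homs H (@Kmm_adj m)) \prod_x
  ((4 * m%:R)^-1%:P * (if (f x).2 then 1 - 'X else 1 + 'X))) => s.
rewrite horner_sum; apply: eq_bigr => f _; rewrite horner_prod; apply: eq_bigr => x _.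
rewrite /Kmm_w hornerM hornerC mulrC; congr (_ * _).
by case: (f x).2; rewrite !hornerE.
Qed.

Lemma Kmm_dens0 : Kmm_dens 0 = 2^-1 ^+ #|H| * tdens R (@Kmm_adj m) H.
Proof.
have cl : #|Kmm m| = (m * 2)%N by rewrite card_prod card_ord card_bool.
rewrite /Kmm_dens /pattern_dens (eq_bigr (fun=> ((4 * m%:R)^-1) ^+ #|H|)) => [|f _].
  rewrite sumr_const -[_ *+ _]mulr_natl /tdens cl mulrCA -exprVn -exprMn; congr (_ * _ ^+ _).
  by rewrite natrM; field.
rewrite (eq_bigr (fun=> (4 * m%:R)^-1)) ?prodr_const // => x _.
by rewrite /Kmm_w subr0 addr0 if_same mul1r.
Qed.

Lemma Kmm_dens1 :
  Kmm_dens 1 = 2^-1 ^+ #|H| * (#|homs H (@eq_op 'I_m)|%:R / m%:R ^+ #|H|).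
Proof.
pose up (f : {ffun H -> 'I_m}) : {ffun H -> Kmm m} := [ffun x => (f x, false)].
have up_inj : injective up.
  by move=> f g /ffunP E; apply/ffunP => x; have := E x; rewrite !ffunE => -[].
have up_hom f : (up f \in homs H (@Kmm_adj m)) = (f \in homs H (@eq_op 'I_m)).
  by apply/idP/idP => /homsP h; apply/homsP => x y /h; rewrite !ffunE.
rewrite /Kmm_dens /pattern_dens (bigID (fun f : {ffun H -> Kmm m} => [forall x, ~~ (f x).2])) /=.
rewrite [X in _ + X]big1 ?addr0 => [|f /andP[_]]; last first.
  rewrite negb_forall => /existsP[x /negPn fx].
  by rewrite (bigD1 x) //= {1}/Kmm_w fx subrr mul0r mul0r.
rewrite (eq_bigr (fun=> ((2 * m%:R)^-1) ^+ #|H|)) => [|f /andP[_ /forallP hf]]; last first.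
  rewrite (eq_bigr (fun=> (2 * m%:R)^-1)) ?prodr_const // => x _.
  by rewrite /Kmm_w (negPf (hf x)); field.
rewrite sumr_const -[_ *+ _]mulr_natl mulrCA -exprVn -exprMn.
have -> : #|[pred f in homs H (@Kmm_adj m) | [forall x, ~~ (f x).2]]| =
   #|homs H (@eq_op 'I_m)|.
  rewrite -(card_imset _ up_inj); apply: eq_card => f; rewrite inE.
  apply/andP/imsetP => [[fh /forallP ff]|[g gh ->]]; last first.
    by rewrite up_hom; split=> //; apply/forallP => x; rewrite ffunE.
  have fE : f = up [ffun x => (f x).1].
    by apply/ffunP => x; rewrite !ffunE; have := ff x; case: (f x) => i [].
  by exists [ffun x => (f x).1] => //; rewrite -up_hom -fE.
congr (_ * _ ^+ _); by field.
Qed.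

Lemma Kmm_dens_gt0 s : 0 <= s <= 1 -> 0 < Kmm_dens s.
Proof.
move=> s01; pose f0 : {ffun H -> Kmm m} := [ffun => (Ordinal m0, false)].
have f0h : f0 \in homs H (@Kmm_adj m).
  by apply/homsP => x y _; rewrite !ffunE /Kmm_adj eqxx orbT.
rewrite /Kmm_dens /pattern_dens (bigD1 f0) //= ltr_pwDl //.
  apply: prodr_gt0 => x _; rewrite ffunE /Kmm_w /= divr_gt0 ?mulr_gt0 //.
  by move: s01; lra.
by apply: sumr_ge0 => f _; apply: prodr_ge0 => x _; apply: Kmm_w_ge0.
Qed.

Lemma Kmm_dens_lt1 s : (0 < #|H|)%N -> 0 <= s <= 1 -> Kmm_dens s < 1.
Proof.
move=> H0 s01; apply: (@le_lt_trans _ _ (2^-1 ^+ #|H|)); last first.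
  by rewrite exprn_ilt1 -?lt0n // ?invr_ge0 // invf_lt1 // ltr1n.
rewrite -(Kmm_w_sum s) -prodr_const.
rewrite (bigA_distr_bigA (fun (x : H) u => Kmm_w s u)) /Kmm_dens /pattern_dens.
rewrite big_mkcond /=; apply: ler_sum => f _; case: ifP => // _.
by apply: prodr_ge0 => x _; apply: Kmm_w_ge0.
Qed.
End CliqueWeights.

Section NotQuasirandom.
Local Open Scope ring_scope.
Variables (R : realType) (V : finType) (A : rel V) (w : V -> R).
Hypotheses (Asym : symmetric A) (w0 : forall v, 0 <= w v) (wsum : \sum_v w v <= 2^-1).

Definition point_graph : sgraph :=
  @SGraph unit (fun _ _ => false) (fun _ _ => erefl) (fun _ => erefl).
Definition star k : sgraph := pendant k (rooted (tt : point_graph)).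

Lemma edges_star k : #|edges (star k)| = k.
Proof.
apply: card_edges_arcs; rewrite (arcs_pendant k (F := rooted (tt : point_graph)) (z := tt)) //.
by rewrite /arcs big1 // => x _; rewrite big1.
Qed.

Lemma tdens_star (W : finType) (B : rel W) k : symmetric B -> (0 < #|W|)%N ->
  tdens R B (star k) = avg (fun x => ndeg R B x ^+ k).
Proof.
move=> Bsym W0; rewrite /tdens card_pendant card_unit.
rewrite (card_homs_rhom (inl tt : star k)).
apply: (@avg_of_sum R _ W0 _ _ k) => // v.
rewrite (@rhom_pendant k (rooted (tt : point_graph)) tt) //.
have -> : @rhom point_graph tt W B v = 1%N.
  rewrite /rhom -(cards1 [ffun _ : point_graph => v]); apply: eq_card => f.
  rewrite finset.in_set1 [LHS]inE; apply/andP/eqP => [[_ /eqP <-]|->].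
    by apply/ffunP => -[]; rewrite ffunE.
  by split; [apply/homsP | rewrite ffunE].
by rewrite mul1n natrX degR // exprMn.
Qed.

(** At least half of the vertices have degree zero. *)
Lemma blowup_degree_CS n :
  avg (ndeg R (@adj (blowup w Asym n.+1))) ^+ 2 <=
  2^-1 * avg (fun x => ndeg R (@adj (blowup w Asym n.+1)) x ^+ 2).
Proof.
set d := ndeg _ _.
pose S (x : 'I_n.+1) : bool := part (psize w n.+1) x != None.
have n0 : (0 < #|'I_n.+1|)%N by rewrite card_ord.
have dS : avg d = avg (fun x => (S x)%:R * d x).
  apply: eq_avg => x; rewrite /S; case E : (part _ x) => [v|] /=; first by rewrite mul1r.
  rewrite mul0r /d /ndeg /aop -[RHS](avg_const n0); apply: eq_avg => y.
  by rewrite /= /blowup_adj /looped_adj E /= andbF mul0r.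
have cS : avg (fun x => (S x)%:R ^+ 2 : R) <= 2^-1.
  rewrite /avg card_ord ler_pdivrMl ?ltr0n // mulrC.
  apply: le_trans (psize_sum w0 wsum n.+1).
  have -> : \sum_x (S x)%:R ^+ 2 = (\sum_x S x)%N%:R :> R.
    by rewrite natr_sum; apply: eq_bigr => x _; case: (S x); rewrite ?expr1n ?expr0n.
  rewrite ler_nat.
  under [leqRHS]eq_bigr => v _ do
    rewrite -(card_part v (psize_sum_le w0 wsum n.+1)) -sum1_card big_mkcond /=.
  rewrite exchange_big /=; apply: leq_sum => x _; rewrite /S.
  case E : (part _ x) => [v|] //=.
  by rewrite (bigD1 v) //= inE E eqxx.
rewrite dS; apply: le_trans (avg_CS _ _) _.
by rewrite ler_wpM2r //; apply: avg_ge0 => x; exact: sqr_ge0.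
Qed.

(** Stars with one and two leaves would give E[d] = p and E[d^2] = p^2, against
    [blowup_degree_CS]. *)
Lemma blowup_not_quasirandom (p : R) : 0 < p ->
  ~ quasirandom (blowup w Asym) p.
Proof.
move=> p0 qr.
have Gn n : #|blowup w Asym n| = n by rewrite card_ord.
have G0 n : (0 < #|blowup w Asym n.+1|)%N by rewrite card_ord.
have lim k : ((fun n => avg (fun x => ndeg R (@adj (blowup w Asym n.+1)) x ^+ k))
    @ \oo --> p ^+ k)%classic.
  have := qr (star k); rewrite hom_asympE // edges_star.
  by under eq_fun do rewrite (tdens_star _ (@adj_sym _)) //.
have := lim 1%N; under eq_fun do under eq_avg do rewrite expr1.
rewrite expr1 => lim1.
have h1 := cvgXn (k := 2) lim1.
have h2 : ((fun n => 2^-1 * avg (fun x => ndeg R (@adj (blowup w Asym n.+1)) x ^+ 2))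
    @ \oo --> 2^-1 * p ^+ 2)%classic.
  by apply: cvgM; [exact: cvg_cst|exact: lim].
have : p ^+ 2 <= 2^-1 * p ^+ 2.
  by apply: (ler_cvg_to h1 h2); near=> n; exact: blowup_degree_CS.
by have : 0 < p ^+ 2 by [rewrite exprn_gt0]; lra.
Unshelve. all: by end_near.
Qed.
End NotQuasirandom.

(** * Pairs are not forcing *)

Section NotForcing.
Local Open Scope ring_scope.
Variables (R : realType) (T : sgraph) (z : T).
Hypotheses (Tcon : connected_graph T) (Tnonbip : ~ bipartite_graph T).
Local Notation K m := (@Kmm_adj m.+1).
Local Notation N := #|T|.
Local Notation M := #|edges T|.

Let N1 : (1 < N)%N := order_gt1 Tnonbip.
Let NM : (N <= M)%N := order_le_size z Tcon Tnonbip.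
Let cardK m : #|Kmm m.+1| = (m.+1 * 2)%N.
Proof. by rewrite card_prod card_ord card_bool. Qed.
Let K0 m : (0 < #|Kmm m.+1|)%N. Proof. by rewrite cardK. Qed.

(** By vertex-transitivity the root may be sent to any vertex ([phiE]). *)
Definition phi m : R := nrhom R z (K m) (ord0, false).

Lemma phiE m u : nrhom R z (K m) u = phi m.
Proof. by rewrite /phi /nrhom (rhom_Kmm z u (ord0, false)). Qed.

Lemma phi_gt0 m : 0 < phi m.
Proof.
rewrite divr_gt0 ?exprn_gt0 ?ltr0n ?K0 //.
by apply: rhom_gt0; rewrite /Kmm_adj eqxx orbT.
Qed.

Lemma phi_le1 m : phi m <= 1.
Proof. exact: nrhom_le1. Qed.

Lemma phi_small m : phi m <= (N ^ 2)%:R * m.+1%:R^-1.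
Proof.
have n0 : (0 < m.+1 * 2)%N by lia.
have -> : phi m = tdens R (K m) T.
  by rewrite (tdens_T R z) // (eq_avg (phiE (m := m))) avg_const.
have /(_ m.+1) le := card_homs_Kmm _ Tnonbip.
rewrite /tdens cardK ler_pdivrMr ?exprn_gt0 ?ltr0n //.
apply: (@le_trans _ _ ((N ^ 2)%:R * (m.+1 * 2)%:R ^+ N.-1)).
  by rewrite -natrX -natrM ler_nat.
have -> : (m.+1 * 2)%:R ^+ N = (m.+1 * 2)%:R * (m.+1 * 2)%:R ^+ N.-1 :> R.
  by rewrite -exprS prednK // ltnW.
rewrite -mulrA ler_wpM2l // mulrA ler_peMl ?exprn_ge0 //.
by rewrite ler_pdivlMl ?ltr0n // mulr1 ler_nat; lia.
Qed.

(** What the comparison of densities along the path needs: by [profile_cliques] the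
    density is of order m^(1-|F|) at the end, and by [profile_Kmm] it is of order phi^i
    at the start. *)
Record profile (F : sgraph) (i : nat) : Prop := Profile {
  profile_order : (0 < #|F|)%N;
  profile_size : (0 < #|edges F|)%N;
  profile_no_isolated : no_isolated F;
  profile_cliques : forall m, #|homs F (@eq_op 'I_m)| = m;
  profile_Kmm : exists2 l : R, 0 < l &
    forall m, l * phi m ^+ i <= tdens R (K m) F <= phi m ^+ i }.

(** At s = 0 the inequality between i1 and i2 makes F1 rarer than F2, relative to the
    numbers of edges, and at s = 1 the inequality between the numbers of vertices makes it
    more frequent, once m is large. The polynomial h1^e(F2) - h2^e(F1) in s therefore has a
    root in [0,1]. There p = h1^(1/e(F1)) = h2^(1/e(F2)), and p < 1 because of the
    isolated vertices. *)
Lemma not_forcing_pair F1 F2 i1 i2 : profile F1 i1 -> profile F2 i2 ->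
  (#|F1|.-1 * #|edges F2| < #|F2|.-1 * #|edges F1|)%N ->
  (i2 * #|edges F1| < i1 * #|edges F2|)%N ->
  ~ forcing R (pair_set F1 F2).
Proof.
move=> [v1 e1 iso1 cl1 [l1 l10 lad1]] [v2 e2 iso2 cl2 [l2 l20 lad2]] hv hi force.
set e_1 := #|edges F1| in e1 hv hi *; set e_2 := #|edges F2| in e2 hv hi *.
pose b1 : R := (2^-1 ^+ #|F2| * l2) ^+ e_1.
pose b2 : R := (2^-1 ^+ #|F1|) ^+ e_2.
have half0 k : 0 < (2^-1 : R) ^+ k by rewrite exprn_gt0.
have half1 k : (2^-1 : R) ^+ k <= 1 by rewrite exprn_ile1 // invf_le1 // ler1n.
have b10 : 0 < b1 by rewrite exprn_gt0 // mulr_gt0.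
have b20 : 0 < b2 by rewrite exprn_gt0.
have [m [m1 m2]] : exists m, phi m <= b1 /\ m.+1%:R^-1 <= b2.
  (* Both requirements are lower bounds on m.+1. *)
  pose a := (N ^ 2)%:R / b1 + b2^-1.
  have a1 : 0 <= (N ^ 2)%:R / b1 by rewrite divr_ge0 // ltW.
  have a2 : 0 < b2^-1 by rewrite invr_gt0.
  exists (Num.truncn a).
  have /andP[_ up] := truncn_itv (addr_ge0 a1 (ltW a2)).
  set k := Num.truncn a in up *; have k0 : (0 : R) < k.+1%:R by rewrite ltr0n.
  split; last first.
    rewrite -[leRHS]invrK lef_pV2 ?posrE //; apply: le_trans (ltW up).
    by rewrite /a lerDr.
  apply: le_trans (phi_small k) _; rewrite ler_pdivrMr //.
  rewrite -ler_pdivrMl // mulrC; apply: le_trans (ltW up).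
  by rewrite lerDl ltW.
have [P1 P1E] := Kmm_dens_poly R m.+1 F1.
have [P2 P2E] := Kmm_dens_poly R m.+1 F2.
have ph0 := phi_gt0 m; have ph1 := phi_le1 m.
have /andP[_ up1] := lad1 m; have /andP[lo2 _] := lad2 m.
have [||s s01 sroot] := @poly_ivt _ (P1 ^+ e_2 - P2 ^+ e_1) 0 1; first exact: ler01.
  rewrite !hornerE !P1E !P2E; apply/andP; split.
    rewrite subr_le0 !Kmm_dens0 //.
    apply: (@le_trans _ _ (phi m ^+ (i1 * e_2))).
      rewrite exprM; apply: lerXn2r; rewrite ?nnegrE ?exprn_ge0 ?(ltW ph0) //.
        by rewrite mulr_ge0 ?(ltW (half0 _)) // divr_ge0 ?exprn_ge0.
      apply: le_trans up1; rewrite -[leRHS]mul1r ler_wpM2r //.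
      by rewrite divr_ge0 ?exprn_ge0.
    apply: (@le_trans _ _ (phi m ^+ (i2 * e_1) * b1)).
      apply: (@le_trans _ _ (phi m ^+ (i2 * e_1).+1)).
        by apply: ler_wiXn2l => //; exact: ltW.
      by rewrite exprSr ler_wpM2l // exprn_ge0 // ltW.
    rewrite /b1 exprM -exprMn; apply: lerXn2r; rewrite ?nnegrE.
    - by apply: ltW; apply: mulr_gt0; [rewrite exprn_gt0|apply: mulr_gt0].
    - by rewrite mulr_ge0 ?(ltW (half0 _)) // divr_ge0 ?exprn_ge0.
    - by rewrite mulrCA ler_wpM2l ?(ltW (half0 _)) // mulrC.
  rewrite subr_ge0 !Kmm_dens1 // cl1 cl2.
  have E v : (0 < v)%N -> m.+1%:R / m.+1%:R ^+ v = m.+1%:R^-1 ^+ v.-1 :> R.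
    case: v => // v _; rewrite exprS invfM mulrA mulfV ?pnatr_eq0 // mul1r.
    by rewrite exprVn.
  rewrite !E // !exprMn -!exprM; set eps := m.+1%:R^-1 in m2 *.
  have eps0 : 0 <= eps by rewrite invr_ge0.
  have eps1 : eps <= 1 by rewrite invf_le1 ?ltr0n // ler1n.
  apply: (@le_trans _ _ (eps ^+ (#|F2|.-1 * e_1))).
    by rewrite -[leRHS]mul1r ler_wpM2r ?exprn_ge0.
  apply: (@le_trans _ _ (eps ^+ (#|F1|.-1 * e_2).+1)).
    exact: ler_wiXn2l.
  rewrite exprSr mulrC ler_wpM2r ?exprn_ge0 //.
  by rewrite exprM.
move: sroot; rewrite /root !hornerE P1E P2E subr_eq0 => /eqP hs.
set h1 := Kmm_dens m.+1 F1 s in hs; set h2 := Kmm_dens m.+1 F2 s in hs.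
have h10 : 0 < h1 by exact: Kmm_dens_gt0.
have h20 : 0 < h2 by exact: Kmm_dens_gt0.
have h1lt : h1 < 1 by exact: Kmm_dens_lt1.
pose p := h1 `^ (e_1%:R^-1).
have p0 : 0 < p by exact: powR_gt0.
have pe1 : p ^+ e_1 = h1.
  by rewrite -powR_mulrn ?(ltW p0) // -powRrM mulVf ?powRr1 ?(ltW h10) // pnatr_eq0 -lt0n.
have pe2 : p ^+ e_2 = h2.
  apply: (pexpIrn e1); rewrite ?nnegrE ?exprn_ge0 ?(ltW p0) ?(ltW h20) //.
  by rewrite -hs -pe1 -!exprM mulnC.
have p1 : p < 1.
  by rewrite -(@ltr_pXn2r _ e_1) ?nnegrE ?(ltW p0) // expr1n pe1.
have w0 u := @Kmm_w_ge0 R m.+1 s u s01.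
have ws : \sum_u Kmm_w (m := m.+1) s u <= 2^-1 by rewrite Kmm_w_sum.
have nq := @blowup_not_quasirandom R _ _ _ (@Kmm_sym m.+1) w0 ws p p0.
apply: nq.
apply: force; [by move=> n; rewrite card_ord|by rewrite p0|].
move=> F [] ->; (rewrite hom_asympE; last by move=> n; rewrite card_ord).
  by rewrite -/e_1 pe1; apply: blowup_cvg.
by rewrite -/e_2 pe2; apply: blowup_cvg.
Qed.

Lemma not_forcing_sym F1 F2 : ~ forcing R (pair_set F1 F2) -> ~ forcing R (pair_set F2 F1).
Proof.
move=> nf force; apply: nf => G p Gn p01 h; apply: force Gn p01 _ => F hF.
by apply: h; case: hF => ->; [right|left].
Qed.

Let d m := (m.+2)%:R / (m.+1 * 2)%:R : R.
Let degK m u : ndeg R (K m) u = d m.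
Proof. by rewrite ndegE cardK deg_Kmm. Qed.
Let d_ge m : 2^-1 <= d m.
Proof.
rewrite ler_pdivlMr ?ltr0n; last by lia.
by rewrite natrM mulrCA mulVf ?mulr1 // ler_nat.
Qed.
Let d_le1 m : d m <= 1.
Proof. by rewrite ler_pdivrMr ?ltr0n ?mul1r ?ler_nat; lia. Qed.
Let d_ge0 m : 0 <= d m. Proof. by apply: le_trans (d_ge m); rewrite invr_ge0. Qed.
Let wsq_ge m k : 2^-1 ^+ (2 * k.+1) <= wsq R (K m) k.
Proof.
apply: le_trans _ (avg_ndeg_wsq R (@Kmm_sym m.+1) (K0 m) k).
rewrite (eq_avg (degK (m := m))) avg_const //.
by apply: lerXn2r; rewrite ?nnegrE ?invr_ge0.
Qed.
Let wsq_le1 m k : wsq R (K m) k <= 1.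
Proof.
apply: avg_le1 => // u; apply: avg_le1 => // v.
by rewrite exprn_ile1 ?nwalk_ge0 ?nwalk_le1.
Qed.
Let half_gt0 k : 0 < (2^-1 : R) ^+ k. Proof. by rewrite exprn_gt0. Qed.

Lemma profile_bound (F : sgraph) i (k : nat) (c : nat -> R) :
  (forall m, tdens R (K m) F = phi m ^+ i * c m) ->
  (forall m, 2^-1 ^+ k <= c m <= 1) ->
  exists2 l : R, 0 < l & forall m, l * phi m ^+ i <= tdens R (K m) F <= phi m ^+ i.
Proof.
move=> Fc c01; exists (2^-1 ^+ k) => // m; rewrite Fc.
have ph0 : 0 <= phi m ^+ i by rewrite exprn_ge0 // ltW // phi_gt0.
have /andP[lo up] := c01 m.
by rewrite mulrC ler_wpM2l //= -[leRHS]mulr1 ler_wpM2l.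
Qed.

Let rhom1 m (v : 'I_m) : rhom z (@eq_op 'I_m) v = 1%N := rhom_eq z Tcon v.
Let deg1 m (v : 'I_m) : deg (@eq_op 'I_m) v = 1%N.
Proof.
rewrite degE (bigD1 v) //= eqxx big1 // => u.
by rewrite eq_sym => /negPf ->.
Qed.
Let walks1 m k (u v : 'I_m) : walks (@eq_op 'I_m) k u v = (u == v).
Proof.
elim: k u => //= k IH u; rewrite (bigD1 u) //= eqxx IH mul1n big1 ?addn0 // => x.
by rewrite eq_sym => /negPf ->.
Qed.
Let sum_diag m (u : 'I_m) : (\sum_(v < m) (u == v) = 1)%N.
Proof. by have := deg1 u; rewrite degE. Qed.
Let T_iso := connected_no_isolated Tcon Tnonbip.
Let TS := lab_rooted z.

Lemma profile_T : profile T 1.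
Proof.
split=> //.
- by lia.
- by lia.
- by move=> m; rewrite (hom_T z) (eq_bigr _ (fun v _ => rhom1 v)) sum1_card card_ord.
- apply: (@profile_bound _ _ 0 (fun=> 1)) => m; last by rewrite expr0 !lexx.
  by rewrite (tdens_T R z) // (eq_avg (phiE (m := m))) avg_const // mulr1.
Qed.

Lemma profile_T' : profile (T' z) 1.
Proof.
split; rewrite ?card_T' ?edges_T'; try lia.
- exact: no_isolated_pendant TS T_iso.
- move=> m; rewrite hom_T' //; under eq_bigr => v _ do rewrite rhom1 deg1.
  by rewrite sum1_card card_ord.
- apply: (@profile_bound _ _ 1 d) => m; last by rewrite expr1 d_ge d_le1.
  rewrite tdens_T' //; last exact: Kmm_sym.
  by rewrite (eq_avg (fun v => congr2 *%R (phiE v) (degK v))) avg_const.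
Qed.

Lemma profile_edge_double : profile (edge_double z) 2.
Proof.
split; rewrite ?card_edge_double ?edges_edge_double; try lia.
- by apply: no_isolated_db; exact: no_isolated_pendant TS T_iso.
- move=> m; rewrite hom_edge_double //; under eq_bigr => v _ do rewrite rhom1 deg1.
  by rewrite sum1_card card_ord.
- apply: (@profile_bound _ _ 1 d) => m; last by rewrite expr1 d_ge d_le1.
  rewrite tdens_edge_double //; last exact: Kmm_sym.
  by under eq_avg => v do rewrite phiE degK; rewrite avg_const.
Qed.

Lemma profile_edge : profile edge_graph 0.
Proof.
split; rewrite ?card_bool ?card_edges_edge_graph //.
- by case; [exists false|exists true].
- move=> m; rewrite card_homs_edge_graph //; under eq_bigr => v _ do rewrite deg1.
  by rewrite sum1_card card_ord.
- apply: (@profile_bound _ _ 1 d) => m; last by rewrite expr1 d_ge d_le1.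
  rewrite tdens_edge //; last exact: Kmm_sym.
  by rewrite (eq_avg (degK (m := m))) avg_const // expr0 mul1r.
Qed.

Lemma profile_cycle : profile (cycle_graph (2 * N)) 0.
Proof.
split; rewrite ?card_ord ?card_edges_cycle; try lia.
- by apply: no_isolated_cycle; lia.
- move=> m; rewrite card_homs_cycle_double //; last by lia.
  under eq_bigr => u _ do under eq_bigr => v _ do rewrite walks1.
  transitivity (\sum_(u < m) 1)%N; last by rewrite sum1_card card_ord.
  apply: eq_bigr => u _; rewrite -[RHS](sum_diag u).
  by apply: eq_bigr => v _; case: (u == v).
- apply: (@profile_bound _ _ (2 * N.-1.+1) (fun m => wsq R (K m) N.-1)) => m.
    by rewrite (tdens_cycle R z) // ?expr0 ?mul1r //; exact: Kmm_sym.
  by rewrite wsq_ge wsq_le1.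
Qed.

Lemma profile_C4_quad : profile (C4_quad z) 8.
Proof.
split; rewrite ?edges_C4_quad; try lia.
- by have := card_C4_quad z; lia.
- apply: no_isolated_db; apply: no_isolated_pendant (lab_db0 (lab_db0 TS)) _.
  by do 2!apply: no_isolated_db.
- move=> m; rewrite hom_C4_quad //; under eq_bigr => u _ do rewrite rhom1 mul1n;
    under eq_bigr => u _ do under eq_bigr => v _ do rewrite rhom1 walks1 mul1n.
  transitivity (\sum_(u < m) 1)%N; last by rewrite sum1_card card_ord.
  apply: eq_bigr => u _; rewrite -[RHS](sum_diag u).
  by apply: eq_bigr => v _; case: (u == v).
- apply: (@profile_bound _ _ 4 (fun m => wsq R (K m) 1)) => m; last first.
    by rewrite (wsq_ge m 1) wsq_le1.
  rewrite tdens_C4_quad //; last exact: Kmm_sym.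
  rewrite /wsq -avgZ; apply: eq_avg => u; rewrite -avgZ; apply: eq_avg => v.
  by rewrite !phiE; ring.
Qed.

Lemma profile_C4_pendants : profile (C4_pendants z) 4.
Proof.
split; rewrite ?edges_C4_pendants ?card_C4_pendants; try lia.
- apply: no_isolated_db; apply: no_isolated_pendant (lab_db0 (lab_pendant0 TS _)) _.
  by apply: no_isolated_db; apply: no_isolated_pendant TS _.
- move=> m; rewrite hom_C4_pendants //.
  under eq_bigr => u _ do rewrite rhom1 deg1 exp1n mul1n;
    under eq_bigr => u _ do under eq_bigr => v _ do rewrite rhom1 deg1 exp1n walks1 mul1n.
  transitivity (\sum_(u < m) 1)%N; last by rewrite sum1_card card_ord.
  apply: eq_bigr => u _; rewrite exp1n mul1n -[RHS](sum_diag u).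
  by apply: eq_bigr => v _; case: (u == v).
- apply: (@profile_bound _ _ (N * 4 + 4) (fun m => d m ^+ (N * 4) * wsq R (K m) 1)) => m.
    rewrite tdens_C4_pendants //; last exact: Kmm_sym.
    rewrite mulrA /wsq -avgZ; apply: eq_avg => u; rewrite -avgZ; apply: eq_avg => v.
    by rewrite !phiE !degK exprM; ring.
  apply/andP; split.
    rewrite exprD; apply: ler_pM; rewrite ?(ltW (half_gt0 _)) ?(wsq_ge m 1) //.
    by apply: lerXn2r; rewrite ?nnegrE ?invr_ge0.
  by rewrite mulr_ile1 ?exprn_ge0 ?exprn_ile1 // (le_trans _ (wsq_ge m 1)) // ltW.
Qed.

End NotForcing.

Lemma not_forcing_triple (R : realType) (a b c F1 F2 : sgraph) :
  ~ forcing R (pair_set a b) -> ~ forcing R (pair_set a c) -> ~ forcing R (pair_set b c) ->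
  triple_set a b c F1 -> triple_set a b c F2 -> F1 <> F2 -> ~ forcing R (pair_set F1 F2).
Proof.
move=> ab ac bc [] -> [] -> //= _.
- exact: not_forcing_sym.
- exact: not_forcing_sym.
- exact: not_forcing_sym.
Qed.

Theorem theorem3p1 (R : realType) (T : sgraph) (z : T) :
  connected_graph T -> ~ bipartite_graph T ->
  forall Hs : graph_set, [\/ Hs = H1 z, Hs = H2 z | Hs = H3 z] ->
  forcing R Hs /\
  (forall F1 F2 : sgraph, Hs F1 -> Hs F2 -> F1 <> F2 ->
     ~ forcing R (pair_set F1 F2)).
Proof.
move=> Tcon Tnonbip.
have N1 := order_gt1 Tnonbip.
have NM := order_le_size z Tcon Tnonbip.
have pT := profile_T R z Tcon Tnonbip; have pT' := profile_T' R z Tcon Tnonbip.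
have pD := profile_edge_double R z Tcon Tnonbip; have pe := profile_edge R z Tcon Tnonbip.
have pC := profile_cycle R z Tcon Tnonbip.
have pQ2 := profile_C4_quad R z Tcon Tnonbip; have pQ3 := profile_C4_pendants R z Tcon Tnonbip.
have cC : #|cycle_graph (2 * #|T|)| = 2 * #|T| by rewrite card_ord.
have eC : #|edges (cycle_graph (2 * #|T|))| = 2 * #|T| by apply: card_edges_cycle; lia.
have ce : #|edge_graph| = 2 by rewrite card_bool.
have := card_T' z; have := edges_T' z; have := card_edge_double z; have := edges_edge_double z.
have := card_C4_quad z; have := edges_C4_quad z.
have := card_C4_pendants z; have := edges_C4_pendants z.
have ee := card_edges_edge_graph => eQ3 cQ3 eQ2 cQ2 eD cD eT' cT'.
move=> Hs [] ->; split.
- move=> G p Gn p01 asymp H; apply/hom_asympE => //.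
  have G0 n : 0 < #|G n.+1| by rewrite Gn.
  apply: (forcing_H1 (z := z) G0 p01).
  + by rewrite -(edges_T' z); apply/hom_asympE => //; apply: asymp; constructor 1.
  + by rewrite -(edges_edge_double z); apply/hom_asympE => //; apply: asymp; constructor 2.
  + by rewrite -[X in (p ^+ X)%R]eC; apply/hom_asympE => //; apply: asymp; constructor 3.
- move=> F1 F2; apply: not_forcing_triple.
  + by apply: not_forcing_sym; apply: (not_forcing_pair Tcon Tnonbip pD pT'); nia.
  + by apply: (not_forcing_pair Tcon Tnonbip pT' pC); nia.
  + by apply: (not_forcing_pair Tcon Tnonbip pD pC); nia.
- move=> G p Gn p01 asymp H; apply/hom_asympE => //.
  have G0 n : 0 < #|G n.+1| by rewrite Gn.
  apply: (forcing_H2 (z := z) G0 p01).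
  + by rewrite -[p]expr1 -[X in (p ^+ X)%R]ee; apply/hom_asympE => //; apply: asymp; constructor 1.
  + by rewrite -(edges_T' z); apply/hom_asympE => //; apply: asymp; constructor 2.
  + by rewrite -(edges_C4_quad z); apply/hom_asympE => //; apply: asymp; constructor 3.
- move=> F1 F2; apply: not_forcing_triple.
  + by apply: not_forcing_sym; apply: (not_forcing_pair Tcon Tnonbip pT' pe); nia.
  + by apply: not_forcing_sym; apply: (not_forcing_pair Tcon Tnonbip pQ2 pe); nia.
  + by apply: not_forcing_sym; apply: (not_forcing_pair Tcon Tnonbip pQ2 pT'); nia.
- move=> G p Gn p01 asymp H; apply/hom_asympE => //.
  have G0 n : 0 < #|G n.+1| by rewrite Gn.
  apply: (forcing_H3 (z := z) G0 p01).
  + by apply/hom_asympE => //; apply: asymp; constructor 1.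
  + by rewrite -(edges_T' z); apply/hom_asympE => //; apply: asymp; constructor 2.
  + by rewrite -(edges_C4_pendants z); apply/hom_asympE => //; apply: asymp; constructor 3.
- move=> F1 F2; apply: not_forcing_triple.
  + by apply: (not_forcing_pair Tcon Tnonbip pT pT'); nia.
  + by apply: (not_forcing_pair Tcon Tnonbip pT pQ3); nia.
  + by apply: (not_forcing_pair Tcon Tnonbip pT' pQ3); nia.
Qed.
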